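(* Fix $z\in\mathbb{C}$ with $|z|>1$. For each $N$ let $\lambda_1,\dots,\lambda_N$ be the eigenvalues of an $N\times N$ complex Ginibre matrix (i.i.d. $\mathcal{N}_{\mathbb{C}}(0,1/N)$ entries) and let $\mathscr{O}_{11}$ be its diagonal overlap associated with $\lambda_1$. Then, as $N\to\infty$, $$\mathbb{E}\left(\mathscr{O}_{11}\mid\lambda_1=z\right)=\frac{|z|^2}{|z|^2-1}+O(N^{-1}).$$
   Context: Ginibre matrix: $G=(G_{ij})_{1\le i,j\le N}$ with i.i.d. entries $G_{ij}\sim\mathcal{N}_{\mathbb{C}}(0,1/N)$, i.e. centered circularly symmetric complex Gaussians with $\mathbb{E}|G_{ij}|^2=1/N$. Overlaps: for a matrix with simple spectrum $\{\lambda_1,\dots,\lambda_N\}$, let $R_i$ be right eigenvectors ($GR_i=\lambda_iR_i$) and $L_i$ left eigenvectors ($L_i^*G=\lambda_iL_i^*$), normalized by $\langle L_i|R_j\rangle=L_i^*R_j=\delta_{ij}$. The matrix of overlaps is $\mathscr{O}_{ij}=\langle L_i|L_j\rangle\langle R_j|R_i\rangle$; in particular $\mathscr{O}_{ii}=\|L_i\|^2\|R_i\|^2$. Conditioning: the eigenvalues are labelled exchangeably, so that $(\lambda_1,\dots,\lambda_N)$ has joint density on $\mathbb{C}^N$ proportional to $\prod_{1\le i<j\le N}|z_i-z_j|^2e^{-N\sum_{i=1}^N|z_i|^2}$. Conditioning on $\{\lambda_1=z\}$ means the usual disintegration: $(\lambda_2,\dots,\lambda_N)$ has density on $\mathbb{C}^{N-1}$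 proportional to $\prod_{k=2}^N|z-z_k|^2\prod_{2\le i<j\le N}|z_i-z_j|^2e^{-N\sum_{i=2}^N|z_i|^2}$, and the conditioned matrix is unitarily conjugate (Schur form) to an upper triangular matrix with diagonal $(z,\lambda_2,\dots,\lambda_N)$ and strictly upper triangular entries i.i.d. $\mathcal{N}_{\mathbb{C}}(0,1/N)$, independent of $(\lambda_2,\dots,\lambda_N)$. Overlaps are invariant under unitary conjugation. *)

(* Defs.v *)
From HB Require Import structures.
From mathcomp Require Import all_boot all_order all_algebra.
From mathcomp Require Import all_classical all_reals all_analysis.
From mathcomp Require Import complex spectral.

Set Implicit Arguments.
Unset Strict Implicit.
Unset Printing Implicit Defensive.

Import Order.TTheory GRing.Theory Num.Theory.
Import numFieldNormedType.Exports.
Import ComplexField.Normc.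

Local Open Scope classical_set_scope.
Local Open Scope ring_scope.
Local Open Scope sesquilinear_scope.

(* The library has binary product measures \x and the product sigma-algebra on
   n.-tuple T, but no n-fold product measure; [power_measure mu n] is the
   product measure of n copies of mu on n.-tuple T. *)
Section tcons.
Context (d : measure_display) (T : measurableType d).

Definition tcons (n : nat) (p : T * n.-tuple T) : n.+1.-tuple T :=
  [tuple of p.1 :: p.2].

Lemma measurable_tcons n : measurable_fun setT (@tcons n).
Proof. exact: measurable_cons measurable_fst measurable_snd. Qed.

Definition tuncons (n : nat) (t : n.+1.-tuple T) : T * n.-tuple T :=
  (thead t, [tuple of behead t]).

Lemma measurable_tuncons n : measurable_fun setT (@tuncons n).
Proof.
apply/measurable_fun_pairP; split; first exact: measurable_tnth.
exact: measurable_behead.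
Qed.

Lemma tconsK n : cancel (@tcons n) (@tuncons n).
Proof. by case=> x t; congr pair; apply/val_inj. Qed.

Lemma tunconsK n : cancel (@tuncons n) (@tcons n).
Proof. by move=> t; rewrite [RHS]tuple_eta; apply/val_inj. Qed.

End tcons.

(* As an instance, the library has this for subprobability measures only. *)
Lemma sigma_finite_product (d1 d2 : measure_display) (T1 : measurableType d1)
    (T2 : measurableType d2) (R : realType)
    (m1 : {sigma_finite_measure set T1 -> \bar R})
    (m2 : {sigma_finite_measure set T2 -> \bar R}) :
  sigma_finite setT (m1 \x m2)%E.
Proof.
have /sigma_finiteP[F [TF ndF Foo]] := sigma_finiteT m1.
have /sigma_finiteP[G [TG ndG Goo]] := sigma_finiteT m2.
exists (fun n => F n `*` G n).
  rewrite -setXTT TF TG predeqE => -[x y]; split.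
    move=> [/= [n _ Fnx] [k _ Gky]]; exists (maxn n k) => //; split.
    - by move: x Fnx; exact/subsetPset/ndF/leq_maxl.
    - by move: y Gky; exact/subsetPset/ndG/leq_maxr.
  by move=> [n _ []/= ? ?]; split; exists n.
move=> k; have [? ?] := Foo k; have [? ?] := Goo k.
split; first exact: measurableX.
by rewrite product_measure1E// lte_mul_pinfty// ge0_fin_numE.
Qed.

Section cons_measure.
Context (d : measure_display) (T : measurableType d) (R : realType) (n : nat).
Variables (mu : {sigma_finite_measure set T -> \bar R})
          (nu : {sigma_finite_measure set (n.-tuple T) -> \bar R}).

Definition cons_measure : set (n.+1.-tuple T) -> \bar R :=
  pushforward (mu \x nu)%E (@tcons d T n).

Let cons_measure0 : cons_measure set0 = 0%E.
Proof. by rewrite /cons_measure /pushforward preimage_set0 measure0. Qed.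

Let cons_measure_ge0 A : (0 <= cons_measure A)%E.
Proof. by rewrite /cons_measure /pushforward measure_ge0. Qed.

Let cons_measure_sigma_additive : semi_sigma_additive cons_measure.
Proof.
move=> F mF tF mUF; rewrite /cons_measure /pushforward preimage_bigcup.
have mtF k : measurable (@tcons d T n @^-1` F k).
  by rewrite -[X in measurable X]setTI; exact: measurable_tcons.
apply: measure_semi_sigma_additive => //.
- apply/trivIsetP => /= i j _ _ ij; rewrite -preimage_setI.
  by move/trivIsetP : tF => /(_ _ _ _ _ ij) ->//; rewrite preimage_set0.
- exact: bigcup_measurable.
Qed.

HB.instance Definition _ := isMeasure.Build _ _ _ cons_measure
  cons_measure0 cons_measure_ge0 cons_measure_sigma_additive.

Let cons_measure_sigma_finite : sigma_finite setT cons_measure.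
Proof.
have [F TF Foo] := sigma_finite_product mu nu.
exists (fun k => @tuncons d T n @^-1` F k).
  by rewrite -preimage_bigcup -TF preimage_setT.
move=> k; have [mFk Fkoo] := Foo k; split.
  by rewrite -[X in measurable X]setTI; exact: measurable_tuncons.
rewrite /cons_measure /pushforward -comp_preimage.
by rewrite (_ : tuncons (n:=n) \o tcons (n:=n) = id)//;
  apply/funext => p /=; rewrite tconsK.
Qed.

HB.instance Definition _ := Measure_isSigmaFinite.Build _ _ _ cons_measure
  cons_measure_sigma_finite.

End cons_measure.

Fixpoint power_measure (d : measure_display) (T : measurableType d)
    (R : realType) (mu : {sigma_finite_measure set T -> \bar R}) (n : nat) :
    {sigma_finite_measure set (n.-tuple T) -> \bar R} :=
  match n with
  | 0 => \d_([tuple] : 0.-tuple T)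
  | m.+1 => cons_measure mu (power_measure mu m)
  end.

Section overlap.
Variables (R : realType) (n : nat).
Notation C := R[i].

(* O is a matrix of overlaps of G, whose eigenvalues are labelled by lam: the
   columns of P are the right eigenvectors and those of L the left ones. *)
Definition is_overlap_mx (G : 'M[C]_n) (lam : 'rV[C]_n) (O : 'M[C]_n) : Prop :=
  exists P L : 'M[C]_n,
    [/\ G *m P = P *m diag_mx lam,
        L^t* *m G = diag_mx lam *m L^t*,
        L^t* *m P = 1%:M
      & O = \matrix_(i, j) ((L^t* *m L) i j * (P^t* *m P) j i)].

(* When the entries of lam are pairwise distinct and are the eigenvalues of G,
   is_overlap_mx G lam holds of exactly one matrix. *)
Definition overlap_mx (G : 'M[C]_n) (lam : 'rV[C]_n) : 'M[C]_n :=
  xget 0 [set O | is_overlap_mx G lam O].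

End overlap.

Section conditioned_ginibre.
Variable R : realType.
Notation C := R[i].

(* R[i] has no measurable structure in the library: the plane carries the
   Borel sigma-algebra and the measures, and toC identifies it with R[i]. *)
Notation plane := (measurableTypeR R * measurableTypeR R)%type.

Definition toC (p : plane) : C := Complex p.1 p.2.

Definition abs2 (w : C) : R := normc w ^+ 2.

Definition lebesgue_C : set plane -> \bar R :=
  (lebesgue_measure \x lebesgue_measure)%E.

HB.instance Definition _ := Measure.on lebesgue_C.

Let lebesgue_C_sigma_finite : sigma_finite setT lebesgue_C.
Proof. exact: sigma_finite_product. Qed.

HB.instance Definition _ := Measure_isSigmaFinite.Build _ _ _ lebesgue_C
  lebesgue_C_sigma_finite.

(* Circularly symmetric, with E|w|^2 = v: the real and imaginary parts are
   independent, centered, of variance v / 2. normal_prob takes the standard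
   deviation. *)
Definition gaussian_C (v : R) : probability plane R :=
  (normal_prob 0 (Num.sqrt (v / 2)) \x normal_prob 0 (Num.sqrt (v / 2)))%E.

Section size.
(* The matrix size is N = n + 1. *)
Variables (z : C) (n : nat).

(* A tuple holds (lambda_2, ..., lambda_N). *)
Definition cond_weight (lam : n.-tuple plane) : R :=
  (\prod_(k < n) abs2 (z - toC (tnth lam k))) *
  (\prod_(i < n) \prod_(j < n | (i < j)%N)
      abs2 (toC (tnth lam i) - toC (tnth lam j))) *
  expR (- (n.+1%:R * \sum_(k < n) abs2 (toC (tnth lam k)))).

Definition cond_partition : R :=
  fine (\int[power_measure lebesgue_C n]_lam (cond_weight lam)%:E)%E.

Definition cond_density (lam : n.-tuple plane) : R :=
  cond_weight lam / cond_partition.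

(* (z, lambda_2, ..., lambda_N) *)
Definition spectrum (lam : n.-tuple plane) : 'rV[C]_n.+1 :=
  \row_(i < n.+1) tnth [tuple of z :: map toC lam] i.

(* Only the entries of g above the diagonal are used. *)
Definition schur_mx (lam : n.-tuple plane)
    (g : n.+1.-tuple (n.+1.-tuple plane)) : 'M[C]_n.+1 :=
  \matrix_(i, j)
    if (i < j)%N then toC (tnth (tnth g i) j)
    else if i == j then spectrum lam 0 i else 0.

Definition gaussian_array :
    {sigma_finite_measure set (n.+1.-tuple (n.+1.-tuple plane)) -> \bar R} :=
  power_measure (power_measure (gaussian_C n.+1%:R^-1) n.+1) n.+1.

Definition diag_overlap (lam : n.-tuple plane)
    (g : n.+1.-tuple (n.+1.-tuple plane)) : R :=
  complex.Re (overlap_mx (schur_mx lam g) (spectrum lam) ord0 ord0).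

(* E(O_11 | lambda_1 = z): given lambda_1 = z, the Ginibre matrix is unitarily
   conjugate to schur_mx lam g, where lam has density cond_density and is
   independent of the i.i.d. complex Gaussian array g. The weight vanishes at
   every non-simple spectrum, so the default value of overlap_mx is
   immaterial. *)
Definition cond_expect_overlap : \bar R :=
  (\int[power_measure lebesgue_C n]_lam
     ((cond_density lam)%:E *
      \int[gaussian_array]_g (diag_overlap lam g)%:E))%E.

End size.
End conditioned_ginibre.

(* Main.v *)
Require Import Defs.
From mathcomp Require Import all_boot all_order all_algebra.
From mathcomp Require Import all_classical all_reals all_analysis.
From mathcomp Require Import perm measurable_realfun complex spectral ring lra.

Import Order.TTheory GRing.Theory Num.Theory.
Import numFieldNormedType.Exports.
Import ComplexField.Normc.

Set Implicit Arguments.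
Unset Strict Implicit.
Unset Printing Implicit Defensive.

Local Open Scope classical_set_scope.
Local Open Scope ring_scope.

(** Put [s = |z|^2], [N = n.+1] and [eps = 1/N]. The conditional expectation is
    computed in closed form for every [N], and the closed form is then
    estimated.

    Given the spectrum, the Schur form is a triangular matrix with corner [z],
    first row [g] and remaining block [T]. Solving the two eigenvector equations
    shows that its overlap is [1 + |g (z - T)^-1|^2] ([upper_overlap]). The rows
    of [T] are independent, and adding a row on top of a triangular matrix changes
    the Gram matrix of the resolvent by an explicit formula
    ([resolvent_gram_block]). By induction on the number of rows, the expected Gram
    matrix is diagonal and
    [1 + eps * (its trace) = \prod_k (1 + eps / |z - lambda_k|^2)]
    ([resolvent_gram_expectation]). The right-hand side is therefore the
    expectation of the overlap given the spectrum ([expected_overlap]).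

    Under the average over the spectrum, this product turns each factor
    [|z - lambda_k|^2] of the density into [|z - lambda_k|^2 + eps]. The partition
    function and the numerator thus have the same shape: a product of functions
    of the single eigenvalues times the squared modulus of a Vandermonde
    determinant. The Andreief identity ([andreief]) makes each of them [n`!] times
    the determinant of the matrix of moments of one eigenvalue. Since
    [w^i * conj w^j] has Gaussian integral zero for [i <> j]
    ([has_cintegral_cmoment]), that matrix is tridiagonal, its determinant obeys a
    three-term recurrence ([det_tridiagonal]), and the recurrences are solved by
    [trunc_exp] and [trunc_exp_sum]. The quotient of these two is the conditional
    expectation ([cond_expect_overlapE]).

    Finally [s * trunc_exp k - (s - k * eps) * trunc_exp_sum k] satisfies a
    first-order recurrence with nonnegative terms and a source of order [eps], which
    bounds it by a constant times [eps * trunc_exp k] ([defect_bounds]). For [k = n], where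
    [k * eps = 1 - eps], this says that the quotient is [s / (s - 1) + O(eps)]
    ([ratio_error]). *)

(** * Integrals of complex-valued functions *)

Section has_integral.
Context (R : realType) (d : measure_display) (T : measurableType d).
Variable mu : {measure set T -> \bar R}.
Notation C := R[i].

(** Integrability and value are packed together, so that the rules below
    establish measurability, integrability and the value in one go. *)
Definition has_integral (f : T -> R) (r : R) : Prop :=
  mu.-integrable setT (EFin \o f) /\ (\int[mu]_x (f x)%:E = r%:E)%E.

Definition has_cintegral (f : T -> C) (c : C) : Prop :=
  has_integral (fun x => complex.Re (f x)) (complex.Re c) /\
  has_integral (fun x => complex.Im (f x)) (complex.Im c).

Lemma has_integralD f g r s : has_integral f r -> has_integral g s ->
  has_integral (fun x => f x + g x) (r + s).
Proof.
move=> [fi fr] [gi gs]; split; first exact: (integrableD measurableT fi gi).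
by under eq_integral do rewrite EFinD; rewrite (integralD measurableT fi gi) fr gs.
Qed.

Lemma has_integralZ a f r : has_integral f r ->
  has_integral (fun x => a * f x) (a * r).
Proof.
move=> [fi fr]; split; first exact: (integrableZl measurableT a fi).
by under eq_integral do rewrite EFinM; rewrite (integralZl measurableT fi) fr.
Qed.

Lemma has_integralN f r : has_integral f r ->
  has_integral (fun x => - f x) (- r).
Proof.
move=> /(has_integralZ (-1)); rewrite mulN1r.
by under eq_fun do rewrite mulN1r.
Qed.

Lemma has_cintegral0 : has_cintegral (fun=> 0) 0.
Proof.
by split; split => /=; [exact: integrable0|exact: integral0|
  exact: integrable0|exact: integral0].
Qed.

Lemma has_cintegralD f g b c : has_cintegral f b -> has_cintegral g c ->
  has_cintegral (fun x => f x + g x) (b + c).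
Proof.
move=> [fr fi] [gr gi]; split.
  by have := has_integralD fr gr; rewrite -raddfD; under eq_fun do rewrite -raddfD.
by have := has_integralD fi gi; rewrite -raddfD; under eq_fun do rewrite -raddfD.
Qed.

Lemma ReM (x y : C) : complex.Re (x * y) =
  complex.Re x * complex.Re y - complex.Im x * complex.Im y.
Proof. by case: x => a b; case: y. Qed.

Lemma ImM (x y : C) : complex.Im (x * y) =
  complex.Re x * complex.Im y + complex.Im x * complex.Re y.
Proof. by case: x => a b; case: y. Qed.

Lemma has_cintegralZ a f c : has_cintegral f c ->
  has_cintegral (fun x => a * f x) (a * c).
Proof.
move=> [fr fi]; split.
  under eq_fun do rewrite ReM.
  by rewrite ReM -mulNr; under eq_fun do rewrite -mulNr;
     apply: has_integralD; exact: has_integralZ.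
under eq_fun do rewrite ImM.
by rewrite ImM; apply: has_integralD; exact: has_integralZ.
Qed.

Lemma has_cintegral_sum (I : Type) (r : seq I) (P : pred I) (F : I -> T -> C)
    (c : I -> C) :
  (forall i, P i -> has_cintegral (F i) (c i)) ->
  has_cintegral (fun x => \sum_(i <- r | P i) F i x) (\sum_(i <- r | P i) c i).
Proof.
move=> Fc; elim: r => [|i r IH].
  by rewrite big_nil; under eq_fun do rewrite big_nil; exact: has_cintegral0.
rewrite big_cons; under eq_fun do rewrite big_cons.
by case: ifPn => // Pi; apply: has_cintegralD => //; exact: Fc.
Qed.

End has_integral.

Lemma has_cintegral_real (R : realType) (d : measure_display) (T : measurableType d)
    (mu : {measure set T -> \bar R}) (f : T -> R) (r : R) :
  has_integral mu f r -> has_cintegral mu (fun x => (f x)%:C%C) r%:C%C.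
Proof.
by move=> fr; split => //=; split; [exact: integrable0|exact: integral0].
Qed.

Lemma has_cintegral_conj (R : realType) (d : measure_display) (T : measurableType d)
    (mu : {measure set T -> \bar R}) (f : T -> R[i]) (c : R[i]) :
  has_cintegral mu f c -> has_cintegral mu (fun x => (f x)^*%C) c^*%C.
Proof.
move=> [fr fi]; split.
  have -> : (fun x => complex.Re (f x)^*%C) = (fun x => complex.Re (f x)).
    by apply/funext => x; case: (f x).
  by case: c fr {fi} => cr ci.
have -> : (fun x => complex.Im (f x)^*%C) = (fun x => - complex.Im (f x)).
  by apply/funext => x; case: (f x).
by case: c fi {fr} => cr ci /has_integralN.
Qed.

Lemma has_integral_unique (R : realType) (d : measure_display) (T : measurableType d)
    (mu : {measure set T -> \bar R}) (f : T -> R) (r s : R) :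
  has_integral mu f r -> has_integral mu f s -> r = s.
Proof. by move=> [_ er] [_ es]; apply/EFin_inj; rewrite -er -es. Qed.

Lemma has_cintegral_unique (R : realType) (d : measure_display) (T : measurableType d)
    (mu : {measure set T -> \bar R}) (f : T -> R[i]) (b c : R[i]) :
  has_cintegral mu f b -> has_cintegral mu f c -> b = c.
Proof.
case: b c => [b b'] [c c'] [/= r i] [/= r' i'].
by rewrite (has_integral_unique r r') (has_integral_unique i i').
Qed.

Lemma has_cintegral_eq (R : realType) (d : measure_display) (T : measurableType d)
    (mu : {measure set T -> \bar R}) (f g : T -> R[i]) b c :
  f =1 g -> b = c -> has_cintegral mu f b -> has_cintegral mu g c.
Proof. by move=> /funext -> ->. Qed.

Section product.
Context (R : realType) (d1 d2 : measure_display).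
Context (T1 : measurableType d1) (T2 : measurableType d2).
Variable m1 : {sigma_finite_measure set T1 -> \bar R}.
Variable m2 : {sigma_finite_measure set T2 -> \bar R}.

Lemma has_integral_prod f g r s : has_integral m1 f r -> has_integral m2 g s ->
  has_integral (m1 \x m2)%E (fun p => f p.1 * g p.2) (r * s).
Proof.
move=> [fi fr] [gi gs].
have mf : measurable_fun setT f by apply/measurable_EFinP; exact: measurable_int fi.
have mg : measurable_fun setT g by apply/measurable_EFinP; exact: measurable_int gi.
have fgi : (m1 \x m2)%E.-integrable setT (EFin \o fun p => f p.1 * g p.2).
  apply/integrable12ltyP.
    apply/measurable_EFinP/measurable_funM.
      exact: measurableT_comp mf measurable_fst.
    exact: measurableT_comp mg measurable_snd.
  rewrite (eq_integral (fun x => `|(f x)%:E| * (\int[m2]_y `|(g y)%:E|))%E); last first.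
    move=> x _; rewrite -ge0_integralZl//.
      by apply: eq_integral => y _; rewrite /= normrM EFinM.
    by apply: measurableT_comp => //; exact/measurable_EFinP.
  have [_ fo] := integrableP _ _ _ fi; have [_ go] := integrableP _ _ _ gi.
  rewrite ge0_integralZr//; first last.
  - exact: integral_ge0.
  - by apply: measurableT_comp => //; exact/measurable_EFinP.
  apply: lte_mul_pinfty => //; first exact: integral_ge0.
  by rewrite ge0_fin_numE//; exact: integral_ge0.
split => //; rewrite -(integral12_prod_meas1 fgi).
transitivity (\int[m1]_x ((f x)%:E * s%:E))%E; last first.
  by rewrite (integralZr measurableT fi) fr.
apply: eq_integral => x _; rewrite /fubini_F /=.
under eq_integral do rewrite EFinM.
by rewrite (integralZl measurableT gi) gs.
Qed.

(** Fubini for functions with separated variables; every multiple integral in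
    this file is a finite sum of such integrals. *)
Lemma has_cintegral_prod f g b c : has_cintegral m1 f b -> has_cintegral m2 g c ->
  has_cintegral (m1 \x m2)%E (fun p => f p.1 * g p.2) (b * c).
Proof.
move=> [fr fi] [gr gi]; split.
  rewrite ReM; under eq_fun do rewrite ReM.
  exact: has_integralD (has_integral_prod fr gr)
    (has_integralN (has_integral_prod fi gi)).
rewrite ImM; under eq_fun do rewrite ImM.
exact: has_integralD (has_integral_prod fr gi) (has_integral_prod fi gr).
Qed.

End product.

Section power.
Context (R : realType) (d : measure_display) (T : measurableType d).
Notation C := R[i].

Lemma has_integral_cons n (mu : {sigma_finite_measure set T -> \bar R})
    (nu : {sigma_finite_measure set (n.-tuple T) -> \bar R}) (f : n.+1.-tuple T -> R) r :
  has_integral (mu \x nu)%E (f \o @tcons d T n) r ->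
  has_integral (cons_measure mu nu) f r.
Proof.
move=> [fi fr].
have mf : measurable_fun setT f.
  have -> : f = (f \o @tcons d T n) \o @tuncons d T n.
    by apply/funext => t /=; rewrite tunconsK.
  apply: measurableT_comp; last exact: measurable_tuncons.
  by apply/measurable_EFinP; exact: measurable_int fi.
have mEf : measurable_fun setT (EFin \o f) by exact/measurable_EFinP.
split.
  by apply: (integrable_pushforward (@measurable_tcons d T n) mEf).
have := integral_pushforward (@measurable_tcons d T n) mEf fi measurableT.
rewrite preimage_setT fr => <-.
by apply: eq_measure_integral => //; exact: measurable_tcons.
Qed.

Lemma has_cintegral_cons n (mu : {sigma_finite_measure set T -> \bar R})
    (nu : {sigma_finite_measure set (n.-tuple T) -> \bar R}) (f : T -> C)
    (g : n.-tuple T -> C) b c :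
  has_cintegral mu f b -> has_cintegral nu g c ->
  has_cintegral (cons_measure mu nu)
    (fun t => f (thead t) * g [tuple of behead t]) (b * c).
Proof.
move=> fb gc; have [hr hi] := has_cintegral_prod fb gc.
have tE t : [tuple of behead (@tcons d T n t)] = t.2 by apply/val_inj.
split; apply: has_integral_cons.
  by congr has_integral: hr; apply/funext => t /=; rewrite tE.
by congr has_integral: hi; apply/funext => t /=; rewrite tE.
Qed.

Lemma has_cintegral_dirac (d' : measure_display) (T' : measurableType d') (a : T') c :
  has_cintegral (\d_a : {measure set T' -> \bar R}) (fun=> c) c.
Proof.
have H (r : R) : has_integral (\d_a : {measure set T' -> \bar R}) (fun=> r) r.
  split; first exact: finite_measure_integrable_cst.
  by rewrite integral_dirac// diracT mul1e.
by split; exact: H.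
Qed.

(** Independence of the coordinates. *)
Lemma has_cintegral_power n (mu : {sigma_finite_measure set T -> \bar R})
    (f : 'I_n -> T -> C) (c : 'I_n -> C) :
  (forall k, has_cintegral mu (f k) (c k)) ->
  has_cintegral (power_measure mu n) (fun t => \prod_(k < n) f k (tnth t k))
    (\prod_(k < n) c k).
Proof.
elim: n f c => [|n IH] f c fc.
  rewrite big_ord0; under eq_fun do rewrite big_ord0.
  exact: has_cintegral_dirac.
rewrite big_ord_recl; under eq_fun do rewrite big_ord_recl.
have := has_cintegral_cons (fc ord0) (IH _ _ (fun k => fc (lift ord0 k))).
congr has_cintegral; apply/funext => t; congr (_ * _).
by apply: eq_bigr => k _; rewrite tnth_behead -lift0 inord_val.
Qed.

Lemma has_cintegral_power1 (mu : {sigma_finite_measure set T -> \bar R}) n :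
  has_cintegral mu (fun=> 1 : C) 1 -> has_cintegral (power_measure mu n) (fun=> 1 : C) 1.
Proof.
move=> mu1; have := has_cintegral_power (fun _ : 'I_n => mu1).
by apply: has_cintegral_eq => [t|]; rewrite big1.
Qed.

End power.

Section density.
Context (R : realType) (d : measure_display) (T : measurableType d).
Variables (nu : {finite_measure set T -> \bar R})
          (mu : {sigma_finite_measure set T -> \bar R}).
Variable h : T -> R.
Hypothesis h_ge0 : forall x, 0 <= h x.
Hypothesis mh : measurable_fun setT h.
Hypothesis nuE : forall A, measurable A -> (nu A = \int[mu]_(x in A) (h x)%:E)%E.

Let hi : mu.-integrable setT (EFin \o h).
Proof.
apply/integrableP; split; first exact/measurable_EFinP.
under eq_integral do rewrite /= ger0_norm//.
by rewrite -nuE// fin_num_fun_lty//; exact: fin_num_measure.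
Qed.

Let numu : nu `<< mu.
Proof.
apply/null_content_dominatesP => A mA A0; rewrite nuE//.
by apply: null_set_integral => //; apply: measurable_funTS; exact/measurable_EFinP.
Qed.

Import Radon_Nikodym_SigmaFinite.

Let RN_h : ae_eq mu setT (f nu mu) (EFin \o h).
Proof.
apply: integral_ae_eq => //; first exact: f_integrable.
  exact/measurable_EFinP.
by move=> A _ mA; rewrite -f_integral// nuE.
Qed.

Let int_nu g : (forall x, 0 <= g x)%E -> measurable_fun setT g ->
  (\int[nu]_x g x = \int[mu]_x (g x * (h x)%:E))%E.
Proof.
move=> g0 mg; rewrite -(change_of_variables numu)//.
apply: ae_eq_integral => //.
- by apply: emeasurable_funM => //; exact: measurable_int (f_integrable numu).
- by apply: emeasurable_funM => //; exact/measurable_EFinP.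
- exact: ae_eqe_mul2l.
Qed.

(** The change of density formula: [h] is almost everywhere the Radon-Nikodym
    derivative of [nu] with respect to [mu]. *)
Lemma has_integral_density (g : T -> R) r : measurable_fun setT g ->
  has_integral mu (fun x => g x * h x) r -> has_integral nu g r.
Proof.
move=> mg [gi gr].
have mEg : measurable_fun setT (EFin \o g) by exact/measurable_EFinP.
have gnu : nu.-integrable setT (EFin \o g).
  apply/integrableP; split => //.
  rewrite int_nu//; last exact: measurableT_comp.
  have /integrableP[_] := gi.
  congr (_ < _)%E; apply: eq_integral => x _ /=.
  by rewrite normrM (ger0_norm (h_ge0 x)) EFinM.
split => //; rewrite -gr -(Radon_Nikodym_change_of_variables numu measurableT gnu).
apply: ae_eq_integral => //.
- exact: emeasurable_funM.
- by apply/measurable_EFinP; exact: measurable_funM.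
under [X in ae_eq _ _ _ X]eq_fun do rewrite EFinM.
apply: ae_eqe_mul2l.
apply: ae_eq_trans RN_h; apply/ae_eq_sym.
exact: ae_eq_Radon_Nikodym_SigmaFinite.
Qed.

End density.

(** * Gaussian moments *)

Section real_moments.
Variables (R : realType) (a : R).
Hypothesis a_gt0 : 0 < a.
Notation leb := (@lebesgue_measure R).

Definition gauss (x : R) : R := expR (- (a * x ^+ 2)).

Lemma measurable_monomial_gauss k : measurable_fun setT (fun x : R => x ^+ k * gauss x).
Proof.
apply: measurable_funM; first exact: measurable_funX.
apply: measurableT_comp => //; apply: measurableT_comp => //.
by apply: measurable_funM => //; exact: measurable_funX.
Qed.

Let half_gauss (x : R) := expR (- (a / 2 * x ^+ 2)).

(** From [|x| <= exp |x|] one gets [|x|^k <= exp (k * |x|)]; completing the square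
    then absorbs [k * |x|] into half of the Gaussian exponent. *)
Lemma monomial_gauss_le k x :
  `|x ^+ k * gauss x| <= expR (k%:R ^+ 2 / (2 * a)) * half_gauss x.
Proof.
rewrite normrM normrX [X in _ * X]ger0_norm ?expR_ge0// /gauss /half_gauss.
apply: (@le_trans _ _ (expR (k%:R * `|x|) * expR (- (a * x ^+ 2)))).
  apply: ler_wpM2r; first exact: expR_ge0.
  rewrite mulrC expRM_natr; apply: lerXn2r; rewrite ?nnegrE ?expR_ge0//.
  by rewrite (le_trans _ (expR_ge1Dx _))// lerDr.
rewrite -!expRD ler_expR -subr_ge0.
have -> : k%:R ^+ 2 / (2 * a) + - (a / 2 * x ^+ 2) -
    (k%:R * `|x| + - (a * x ^+ 2)) = (k%:R - a * `|x|) ^+ 2 / (2 * a).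
  by rewrite -(real_normK (num_real x)); field; rewrite gt_eqF.
by rewrite divr_ge0 ?sqr_ge0// mulr_ge0 ?ltW.
Qed.

Let sigma : R := (Num.sqrt a)^-1.

Let sigmaE : sigma ^+ 2 = a^-1.
Proof. by rewrite exprVn sqr_sqrtr ?ltW. Qed.

Let sigma_neq0 : sigma != 0.
Proof. by rewrite invr_eq0 gt_eqF// sqrtr_gt0. Qed.

Let half_gauss_integrable : leb.-integrable setT (EFin \o half_gauss).
Proof.
have := integrable_normal_pdf 0 sigma.
move=> /(integrableZl measurableT (normal_peak sigma)^-1).
apply: eq_integrable => // x _ /=.
rewrite normal_pdfE// -EFinM mulrA mulVf ?mul1r; last first.
  by rewrite gt_eqF// normal_peak_gt0.
rewrite /normal_fun sigmaE subr0 /half_gauss; congr (expR _)%:E.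
by field; rewrite gt_eqF.
Qed.

Lemma monomial_gauss_integrable k :
  leb.-integrable setT (EFin \o (fun x => x ^+ k * gauss x)).
Proof.
apply: (le_integrable measurableT _ _
  (integrableZl measurableT (expR (k%:R ^+ 2 / (2 * a))) half_gauss_integrable)).
  by apply/measurable_EFinP; exact: measurable_monomial_gauss.
move=> x _ /=; rewrite lee_fin [leRHS]ger0_norm ?monomial_gauss_le//.
by rewrite mulr_ge0 ?expR_ge0.
Qed.

Definition moment k : R := fine (\int[leb]_x (x ^+ k * gauss x)%:E).

Lemma has_integral_moment k : has_integral leb (fun x => x ^+ k * gauss x) (moment k).
Proof.
have ki := monomial_gauss_integrable k.
by split => //; rewrite fineK//; exact: integrable_fin_num ki.
Qed.

Let F k x := x ^+ k * gauss x.
Let f k x := k%:R * F k.-1 x - 2 * a * F k.+1 x.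

Let dF k (x : R) : is_derive x 1 (F k) (f k x).
Proof.
have dq : is_derive x 1 (- (a \*: (id ^+ 2 : R -> R))) (- (a *: ((2%:R * x ^+ 1) *: 1))).
  by apply: is_deriveN; apply: is_deriveZ; apply: is_deriveX.
have dg : is_derive x 1 (expR \o - (a \*: (id ^+ 2 : R -> R)))
   (gauss x * - (a *: ((2%:R * x ^+ 1) *: 1))).
  exact: (is_derive1_comp (is_derive_expR _) dq).
have := is_deriveM (is_deriveX k (is_derive_id x 1)) dg.
have -> : (id ^+ k : R -> R) * (expR \o - (a \*: (id ^+ 2 : R -> R))) = F k.
  by apply/funext => y; rewrite /F /gauss !fctE.
move=> /is_derive_eq; apply.
rewrite /f /F /gauss /= !fctE /= [x ^+ k.+1]exprS /GRing.scale/=; set e := expR _.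
by ring.
Qed.

Let continuousF k : continuous (F k).
Proof.
move=> x; apply/differentiable_continuous/derivable1_diffP.
by have [] := dF k x.
Qed.

Let continuousf k : continuous (f k).
Proof.
move=> x; rewrite /f; apply: cvgB; apply: cvgM; try exact: cvg_cst; exact: continuousF.
Qed.

Let f_int k : has_integral leb (f k) (k%:R * moment k.-1 - 2 * a * moment k.+1).
Proof.
rewrite /f; apply: has_integralD; first exact: (has_integralZ _ (has_integral_moment _)).
by apply: has_integralN; exact: (has_integralZ _ (has_integral_moment _)).
Qed.

Let itv n : set R := `[- n.+1%:R, n.+1%:R]%classic.

Let int_itv k n : (\int[leb]_(x in itv n) (f k x)%:E =
  (F k n.+1%:R - F k (- n.+1%:R))%:E)%E.
Proof.
rewrite EFinB; apply: continuous_FTC2.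
- by rewrite gtrN.
- exact: continuous_subspaceT.
- split => [x _||]; first by have [] := dF k x.
  + by apply: cvg_at_right_filter; exact: continuousF.
  + by apply: cvg_at_left_filter; exact: continuousF.
- by move=> x _; rewrite derive1E; have [_] := dF k x.
Qed.

Let boundary k : (F k n.+1%:R - F k (- n.+1%:R)) @[n --> \oo] --> (0:R).
Proof.
apply/norm_cvg0P.
pose K := expR (k%:R ^+ 2 / (2 * a)).
apply: (@squeeze_cvgr _ _ _ _ (fun=> 0) (fun n => 4 * K / a * harmonic n)).
- apply: nearW => n; rewrite normr_ge0/=.
  have Fle x : `|x| = n.+1%:R -> `|F k x| <= 2 * K / a * harmonic n.
    move=> xn; apply: le_trans (monomial_gauss_le k x) _.
    rewrite -/K -!mulrA mulrCA; apply: ler_wpM2l; first exact: expR_ge0.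
    have n1 : 1 <= n.+1%:R :> R by rewrite ler1n.
    have n0 : 0 < n.+1%:R :> R by rewrite ltr0n.
    rewrite /half_gauss expRN -(real_normK (num_real x)) xn.
    rewrite mulrA -[harmonic n]invrK -[X in _ <= X]invrK.
    rewrite lef_pV2 ?posrE ?expR_gt0//; last first.
      by rewrite /harmonic/= invrK; rewrite !(mulr_gt0, invr_gt0).
    apply: le_trans (expR_ge1Dx _).
    rewrite /harmonic/= invrK !invfM !invrK.
    have : 0 <= a / 2 * n.+1%:R * (n.+1%:R - 1).
      by apply: mulr_ge0; rewrite ?subr_ge0// ltW// mulr_gt0// divr_gt0.
    set t := n.+1%:R; move=> ?; lra.
  apply: le_trans (ler_normB _ _) _.
  (* one half of the bound for each end of the interval *)
  have -> : 4 * K / a * harmonic n =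
      2 * K / a * harmonic n + 2 * K / a * harmonic n :> R by ring.
  by apply: lerD; apply: Fle; rewrite ?normrN ger0_norm.
- exact: cvg_cst.
- rewrite -[X in _ --> X](mulr0 (4 * K / a)).
  by apply: cvgM; [exact: cvg_cst|exact: cvg_harmonic].
Qed.

(** Integration by parts on the whole line: [x ^+ k * gauss x] tends to zero at
    both ends, so the integral of its derivative vanishes. *)
Lemma momentS k : 2 * a * moment k.+1 = k%:R * moment k.-1.
Proof.
apply/esym/eqP; rewrite -subr_eq0; apply/eqP.
have [fi fE] := f_int k.
have mf : measurable_fun setT (f k) by apply/measurable_EFinP; exact: measurable_int fi.
(* dominated convergence along the intervals, on which the fundamental theorem
   of calculus applies *)
suff lim1 : (fun n => \int[leb]_(x in itv n) (f k x)%:E)%E @ \oo -->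
    (\int[leb]_x (f k x)%:E)%E.
  have lim2 : (fun n => (F k n.+1%:R - F k (- n.+1%:R))%:E) @ \oo --> (0:R)%:E.
    by apply: cvg_EFin; [exact: nearW|exact: boundary].
  have : (fun n => \int[leb]_(x in itv n) (f k x)%:E)%E =
      fun n => (F k n.+1%:R - F k (- n.+1%:R))%:E.
    by apply/funext => n; exact: int_itv.
  move=> e; move: lim1; rewrite e fE => lim1.
  have := cvg_lim (@ereal_hausdorff R) lim1.
  by rewrite (cvg_lim (@ereal_hausdorff R) lim2) => /(_ _)[].
under eq_fun do rewrite integral_mkcond.
apply: (@dominated_cvg _ _ _ leb setT measurableT _ _ (fun x => `|f k x|%:E)) => //.
- move=> n; apply/(measurable_restrictT _ (measurable_itv _)).
  by apply: measurable_funTS; exact/measurable_EFinP.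
- move=> x _; apply: cvg_near_cst.
  near=> n; rewrite /patch ifT//.
  rewrite inE /itv/= in_itv/= -ler_norml.
  apply: (@le_trans _ _ n%:R); last by rewrite ler_nat.
  by near: n; exact: nbhs_infty_ger.
- exact: integrable_abse fi.
- move=> n x _; rewrite /patch; case: ifPn => _ /=; first exact: lexx.
  by rewrite normr0 lee_fin.
Unshelve. all: end_near. Qed.

Lemma moment0_gt0 : 0 < moment 0.
Proof.
have [ki kE] := has_integral_moment 0.
have := integral_normal_pdf 0 (sigma / Num.sqrt 2).
have s0 : sigma / Num.sqrt 2 != 0 by rewrite mulf_neq0// invr_eq0 sqrtr_eq0 -ltNge.
have pdfE x : normal_pdf 0 (sigma / Num.sqrt 2) x =
    normal_peak (sigma / Num.sqrt 2) * (x ^+ 0 * gauss x).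
  rewrite normal_pdfE// expr0 mul1r; congr (_ * _).
  rewrite /normal_fun /gauss subr0 exprMn [(Num.sqrt 2)^-1 ^+ 2]exprVn.
  rewrite sqr_sqrtr// sigmaE; congr expR.
  by field; rewrite gt_eqF.
under eq_integral do rewrite pdfE EFinM.
rewrite (integralZl measurableT ki) kE => -[e].
by rewrite -(pmulr_rgt0 _ (normal_peak_gt0 s0)) e.
Qed.

End real_moments.

Section complex_moments.
Variables (R : realType) (a : R).
Hypothesis a_gt0 : 0 < a.
Notation C := R[i].
Notation plane := (measurableTypeR R * measurableTypeR R)%type.
Notation lebC := (@lebesgue_C R).

Lemma toCE (p : plane) : toC p = p.1%:C%C + 'i%C * p.2%:C%C.
Proof. exact: complexE. Qed.

Lemma conj_toCE (p : plane) : (toC p)^*%C = p.1%:C%C - 'i%C * p.2%:C%C.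
Proof.
case: p => x y; rewrite /toC /=; apply/eqP.
by rewrite eq_complex /= !(mul0r, mulr0, mul1r, subr0, sub0r, addr0, add0r,
  oppr0) !eqxx.
Qed.

Lemma abs2_toC (p : plane) : abs2 (toC p) = p.1 ^+ 2 + p.2 ^+ 2.
Proof. by rewrite /abs2 /= sqr_sqrtr// addr_ge0// sqr_ge0. Qed.

Definition cgauss (p : plane) : C := (expR (- (a * abs2 (toC p))))%:C%C.

Lemma cgaussE p : cgauss p = (gauss a p.1)%:C%C * (gauss a p.2)%:C%C.
Proof. by rewrite /cgauss abs2_toC -rmorphM -expRD mulrDr opprD. Qed.

Lemma has_cintegral_monomial k l :
  has_cintegral lebC (fun p => p.1%:C%C ^+ k * p.2%:C%C ^+ l * cgauss p)
    (moment a k * moment a l)%:C%C.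
Proof.
have := has_cintegral_real (has_integral_prod (has_integral_moment a_gt0 k)
  (has_integral_moment a_gt0 l)).
congr has_cintegral; apply/funext => p.
by rewrite cgaussE !rmorphM !rmorphXn /=; ring.
Qed.

Let h : C := 2^-1.

(** [D] plays the role of the derivative of [F] with respect to the conjugate of
    [w = x + i y]. Integrating by parts against [exp (- a |w|^2)] gives
    [int w * G = (1/a) * int dG] with [dG = (G_x + i G_y) / 2]; the pair requires this
    for every [G = x^k y^l F], with [dG] expanded by the Leibniz rule. The
    multipliers [x^k y^l] make the notion stable under multiplication of [F] by [x]
    and by [y], hence by [w] and by its conjugate. *)
Definition stein_pair (F D : plane -> C) : Prop := forall k l, exists c,
  has_cintegral lebC
    (fun p => toC p * (p.1%:C%C ^+ k * p.2%:C%C ^+ l * F p) * cgauss p) c /\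
  has_cintegral lebC
    (fun p => (p.1%:C%C ^+ k * p.2%:C%C ^+ l * D p +
               h * (k%:R * p.1%:C%C ^+ k.-1 * p.2%:C%C ^+ l +
                    'i%C * (l%:R * p.1%:C%C ^+ k * p.2%:C%C ^+ l.-1)) * F p) * cgauss p)
    (a%:C%C * c).

Lemma stein_pair1 : stein_pair (fun=> 1) (fun=> 0).
Proof.
move=> k l.
exists ((moment a k.+1 * moment a l)%:C%C +
        'i%C * (moment a k * moment a l.+1)%:C%C); split.
  have := has_cintegralD (has_cintegral_monomial k.+1 l)
    (has_cintegralZ 'i%C (has_cintegral_monomial k l.+1)).
  congr has_cintegral; apply/funext => p; rewrite toCE !exprS; ring.
have := has_cintegralD
  (has_cintegralZ (h * k%:R) (has_cintegral_monomial k.-1 l))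
  (has_cintegralZ (h * 'i%C * l%:R) (has_cintegral_monomial k l.-1)).
congr has_cintegral; first by apply/funext => p; ring.
have momS j : (j%:R * moment a j.-1)%:C%C = 2 * a%:C%C * (moment a j.+1)%:C%C.
  by rewrite -momentS// !rmorphM /= rmorph_nat.
have h2 : h * 2 = 1 by rewrite mulVf// pnatr_eq0.
rewrite !rmorphM /=.
have := momS k; have := momS l; rewrite !rmorphM /= !rmorph_nat => el ek.
transitivity (h * (k%:R * (moment a k.-1)%:C%C) * (moment a l)%:C%C +
  h * 'i%C * (l%:R * (moment a l.-1)%:C%C) * (moment a k)%:C%C); first by ring.
by rewrite el ek; ring: h2.
Qed.

Lemma eq_stein_pair F D F' D' : F =1 F' -> D =1 D' -> stein_pair F D -> stein_pair F' D'.
Proof. by move=> /funext <- /funext <-. Qed.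

Lemma stein_pairD F D F' D' : stein_pair F D -> stein_pair F' D' ->
  stein_pair (fun p => F p + F' p) (fun p => D p + D' p).
Proof.
move=> FD FD' k l; have [c [c1 c2]] := FD k l; have [b [b1 b2]] := FD' k l.
exists (c + b); split.
  by have := has_cintegralD c1 b1; congr has_cintegral; apply/funext => p; ring.
have := has_cintegralD c2 b2; congr has_cintegral; last by ring.
by apply/funext => p; ring.
Qed.

Lemma stein_pairZ z F D : stein_pair F D ->
  stein_pair (fun p => z * F p) (fun p => z * D p).
Proof.
move=> FD k l; have [c [c1 c2]] := FD k l.
exists (z * c); split.
  by have := has_cintegralZ z c1; congr has_cintegral; apply/funext => p; ring.
have := has_cintegralZ z c2; congr has_cintegral; last by ring.
by apply/funext => p; ring.
Qed.

Lemma stein_pair_Re F D : stein_pair F D ->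
  stein_pair (fun p => p.1%:C%C * F p) (fun p => p.1%:C%C * D p + h * F p).
Proof.
move=> FD k l; have [c [c1 c2]] := FD k.+1 l; exists c; split.
  by congr has_cintegral: c1; apply/funext => p; rewrite exprS; ring.
congr has_cintegral: c2; apply/funext => p.
by case: k {FD c1} => [|k]; rewrite ?exprS /=; ring.
Qed.

Lemma stein_pair_Im F D : stein_pair F D ->
  stein_pair (fun p => p.2%:C%C * F p) (fun p => p.2%:C%C * D p + h * 'i%C * F p).
Proof.
move=> FD k l; have [c [c1 c2]] := FD k l.+1; exists c; split.
  by congr has_cintegral: c1; apply/funext => p; rewrite exprS; ring.
congr has_cintegral: c2; apply/funext => p.
by case: l {FD c1} => [|l]; rewrite ?exprS /=; ring.
Qed.

Let ii : 'i%C * 'i%C = -1 :> C. Proof. by rewrite -expr2 sqr_i. Qed.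
Let hh : h + h = 1. Proof. by rewrite /h; field. Qed.

Lemma stein_pair_toC F D : stein_pair F D ->
  stein_pair (fun p => toC p * F p) (fun p => toC p * D p).
Proof.
move=> FD; have := stein_pairD (stein_pair_Re FD) (stein_pairZ 'i%C (stein_pair_Im FD)).
by apply: eq_stein_pair => p; rewrite toCE; ring: ii.
Qed.

(** The derivation sends the conjugate of [w] to [1] and, by [stein_pair_toC],
    [w] to [0]. *)
Lemma stein_pair_conj F D : stein_pair F D ->
  stein_pair (fun p => (toC p)^*%C * F p) (fun p => (toC p)^*%C * D p + F p).
Proof.
move=> FD; have := stein_pairD (stein_pair_Re FD) (stein_pairZ (-'i%C) (stein_pair_Im FD)).
by apply: eq_stein_pair => p; rewrite conj_toCE; ring: ii hh.
Qed.

Lemma stein_pair_monomial i j :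
  stein_pair (fun p => toC p ^+ i * (toC p)^*%C ^+ j)
             (fun p => j%:R * (toC p ^+ i * (toC p)^*%C ^+ j.-1)).
Proof.
elim: i => [|i IH].
  elim: j => [|j IH].
    by apply: eq_stein_pair stein_pair1 => p; rewrite ?expr0 ?mul1r ?mul0r.
  apply: eq_stein_pair (stein_pair_conj IH) => p /=; first by rewrite exprS; ring.
  by case: j {IH} => [|j]; rewrite ?exprS /=; ring.
by apply: eq_stein_pair (stein_pair_toC IH) => p; rewrite exprS; ring.
Qed.

Definition cmoment (i j : nat) : C :=
  (i == j)%:R * (i`!%:R / a ^+ i * moment a 0 ^+ 2)%:C%C.

(** Integration by parts lowers both exponents: the integral of
    [w^(i+1) * conj w^j] is [j / a] times that of [w^i * conj w^(j-1)]. Iterating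
    ends at a power of [w] alone or of [conj w] alone, whose integral is zero
    unless the exponent is zero. *)
Lemma has_cintegral_cmoment i j :
  has_cintegral lebC (fun p => toC p ^+ i * (toC p)^*%C ^+ j * cgauss p) (cmoment i j).
Proof.
have aC : a%:C%C != 0 :> C by rewrite fmorph_eq0 gt_eqF.
have int_w i' j' : exists2 c, has_cintegral lebC
    (fun p => toC p ^+ i'.+1 * (toC p)^*%C ^+ j' * cgauss p) c &
    has_cintegral lebC (fun p => j'%:R * (toC p ^+ i' * (toC p)^*%C ^+ j'.-1) * cgauss p)
      (a%:C%C * c).
  have [c [c1 c2]] := stein_pair_monomial i' j' 0 0; exists c.
    by congr has_cintegral: c1; apply/funext => p; rewrite exprS; ring.
  by congr has_cintegral: c2; apply/funext => p; ring.
have int_w0 i' : has_cintegral lebC (fun p => toC p ^+ i'.+1 * cgauss p) 0.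
  have [c c1 c2] := int_w i' 0%N.
  have /eqP : a%:C%C * c = 0.
    apply: has_cintegral_unique c2 _.
    by congr has_cintegral: (has_cintegral0 lebC); apply/funext => p; ring.
  rewrite mulf_eq0 (negbTE aC)/= => /eqP c0; rewrite -c0.
  by congr has_cintegral: c1; apply/funext => p; rewrite expr0 mulr1.
elim: i j => [|i IH] [|j].
- have := has_cintegral_monomial 0 0.
  rewrite /cmoment eqxx mul1r fact0 expr0 divr1 mul1r expr2.
  by congr has_cintegral; apply/funext => p; rewrite !expr0.
- rewrite /cmoment mul0r.
  have := has_cintegral_conj (int_w0 j); rewrite rmorph0.
  congr has_cintegral; apply/funext => p.
  by rewrite rmorphM rmorphXn expr0 mul1r /cgauss/= oppr0.
- rewrite /cmoment mul0r.
  by congr has_cintegral: (int_w0 i); apply/funext => p; rewrite expr0 mulr1.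
have [c c1 c2] := int_w i j.+1.
have -> : cmoment i.+1 j.+1 = c => //.
apply: (mulfI aC).
apply: has_cintegral_unique c2.
have := has_cintegralZ j.+1%:R (IH j).
congr has_cintegral; first by apply/funext => p /=; ring.
rewrite /cmoment eqSS; case: eqVneq => [<-|]; last by rewrite !mul0r !mulr0.
rewrite !mul1r -rmorphM/= -[_.+1%:R](rmorph_nat (real_complex R)) -rmorphM/=.
congr (_%:C)%C.
by rewrite factS [a ^+ _.+1]exprS natrM; field; rewrite ?expf_neq0 gt_eqF.
Qed.

End complex_moments.

(** * Overlaps of an upper triangular matrix *)

Section upper_triangular.
Variable F : fieldType.

Definition upper_mx n (A : 'M[F]_n) : Prop :=
  forall i j : 'I_n, (j < i)%N -> A i j = 0.

Lemma upper_unitmx n (A : 'M[F]_n) : upper_mx A -> (forall i, A i i != 0) ->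
  A \in unitmx.
Proof.
move=> uA A0; rewrite unitmxE unitfE -det_tr det_trig; last first.
  by apply/is_trig_mxP => i j ij; rewrite mxE uA.
by apply/prodf_neq0 => i _; rewrite mxE.
Qed.

Lemma upper_block n (A : 'M[F]_(1 + n)) : upper_mx A ->
  A = block_mx (A ord0 ord0)%:M (ursubmx A) 0 (drsubmx A).
Proof.
move=> uA; rewrite -[LHS]submxK; congr block_mx.
  by rewrite [LHS]mx11_scalar !mxE lshift0.
by apply/matrixP => i j; rewrite !mxE uA//= ord1.
Qed.

Lemma upper_drsubmx n (A : 'M[F]_(1 + n)) : upper_mx A -> upper_mx (drsubmx A).
Proof. by move=> uA i j ji; rewrite !mxE uA//=. Qed.

Lemma upper_scalar_sub n z (A : 'M[F]_n) : upper_mx A -> upper_mx (z%:M - A).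
Proof.
move=> uA i j ji; rewrite !mxE uA// subr0.
by case: eqVneq ji => [->|]; rewrite ?ltnn.
Qed.

Lemma resolvent_unitmx n z (A : 'M[F]_n) : upper_mx A -> (forall i, A i i != z) ->
  z%:M - A \in unitmx.
Proof.
move=> uA Az; apply: upper_unitmx; first exact: upper_scalar_sub.
by move=> i; rewrite !mxE eqxx subr_eq0 eq_sym.
Qed.

Lemma diag_mx_block n (A : 'M[F]_(1 + n)) :
  diag_mx (\row_i A i i) =
  block_mx (A ord0 ord0)%:M 0 0 (diag_mx (\row_i drsubmx A i i)).
Proof.
rewrite [\row_i A i i](_ : _ = row_mx (A ord0 ord0)%:M (\row_i drsubmx A i i)).
  rewrite diag_mx_row; congr block_mx.
  by apply/matrixP => i j; rewrite !mxE !ord1.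
apply/rowP => i; rewrite !mxE; case: splitP => j ij.
  by rewrite ord1 !mxE eqxx; congr (A _ _); apply/val_inj; rewrite /= ij ord1.
by rewrite !mxE; congr (A _ _); apply/val_inj.
Qed.

(** The first row of the block triangular matrix of left eigenvectors is
    [(1, b)] with [b (z - A') = g], where [z], [g], [A'] are the blocks of [A]. *)
Lemma upper_diagonalize n (A : 'M[F]_n) : upper_mx A ->
  injective (fun i => A i i) ->
  exists2 V : 'M[F]_n, V \in unitmx & V *m A = diag_mx (\row_i A i i) *m V.
Proof.
elim: n A => [|n IH] A uA Ai.
  by exists 1%:M; rewrite ?unitmx1// [RHS]thinmx0 [LHS]thinmx0.
move: A uA Ai; rewrite -[n.+1]/(1 + n)%N => A uA Ai.
pose A' := drsubmx A; have uA' : upper_mx A' := upper_drsubmx uA.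
have Ai' : injective (fun i => A' i i).
  by move=> i j; rewrite !mxE => /Ai; exact: rshift_inj.
have [V' V'u V'A] := IH _ uA' Ai'.
pose z := A ord0 ord0.
have zA'u : z%:M - A' \in unitmx.
  apply: resolvent_unitmx => // i; apply/eqP; rewrite !mxE => /Ai.
  by move=> /(congr1 val).
pose b := ursubmx A *m invmx (z%:M - A').
(* the first row of V *m A = D *m V *)
have bE : ursubmx A + b *m A' = z *: b.
  have : b *m (z%:M - A') = ursubmx A by rewrite mulmxKV.
  by rewrite mulmxBr mul_mx_scalar => /eqP; rewrite subr_eq => /eqP ->.
exists (block_mx 1%:M b 0 V').
  by rewrite unitmxE unitfE det_ublock det1 mul1r -unitfE -unitmxE.
rewrite [A in LHS]upper_block// diag_mx_block -/z -/A' !mulmx_block.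
rewrite !(mul1mx, mulmx0, mul0mx, addr0, add0r) mulmx1 V'A bE mul_scalar_mx.
by [].
Qed.

End upper_triangular.

Section overlap.
Variable C : numClosedFieldType.
Local Open Scope sesquilinear_scope.

(** Write [A] in blocks [z], [g], [A'], and let [M] be the inverse of [z - A']. The
    right eigenvector of [z] is a multiple [y] of the first basis vector, the left
    one is [x (1, g M)], and biorthogonality forces [x * y = 1]. *)
Lemma upper_overlap n (A P X : 'M[C]_(1 + n)) :
  upper_mx A -> injective (fun i => A i i) ->
  A *m P = P *m diag_mx (\row_i A i i) ->
  X *m A = diag_mx (\row_i A i i) *m X -> X *m P = 1%:M ->
  (X *m X^t*) ord0 ord0 * (P^t* *m P) ord0 ord0 =
  1 + (\sum_k \sum_l ursubmx A 0 k * 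
    (invmx ((A ord0 ord0)%:M - drsubmx A) *m (invmx ((A ord0 ord0)%:M - drsubmx A))^t*) k l
    * (ursubmx A 0 l)^*).
Proof.
move=> uA Ai AP XA XP.
pose A' := drsubmx A; pose z := A ord0 ord0; pose g := ursubmx A.
rewrite -/A' -/z -/g.
have zA'u : z%:M - A' \in unitmx.
  apply: resolvent_unitmx => [|i]; first exact: upper_drsubmx.
  by apply/eqP; rewrite !mxE => /Ai /(congr1 val).
set M := invmx _.
pose x := X ord0 ord0; pose y := P ord0 ord0.
have q0 : dlsubmx P = 0.
  have := congr1 dlsubmx AP.
  rewrite {1}(upper_block uA) diag_mx_block -{1 2}[P]submxK !mulmx_block !block_mxKdl.
  rewrite mul0mx mulmx0 add0r addr0 mul_mx_scalar -/z -/A' => e.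
  have : (z%:M - A') *m dlsubmx P = 0 by rewrite mulmxBl mul_scalar_mx e subrr.
  by move/(congr1 (mulmx (invmx (z%:M - A')))); rewrite mulKmx// mulmx0.
have bE : ursubmx X = x *: (g *m M).
  have := congr1 ursubmx XA.
  rewrite {1}(upper_block uA) diag_mx_block -{1 2}[X]submxK !mulmx_block !block_mxKur.
  rewrite mul0mx addr0 mul_scalar_mx -/z -/A' -/g => e.
  have : ursubmx X *m (z%:M - A') = x *: g.
    rewrite mulmxBr mul_mx_scalar -e addrK.
    rewrite [ulsubmx X]mx11_scalar mul_scalar_mx !mxE lshift0//.
  by move/(congr1 (mulmx^~ M)); rewrite mulmxK// scalemxAl.
have xy1 : x * y = 1.
  have := congr1 (fun B => ulsubmx B 0 0) XP.
  rewrite -{1}[X]submxK -{1}[P]submxK mulmx_block block_mxKul q0 mulmx0 addr0.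
  by rewrite !mxE big_ord1 !mxE !lshift0 eqxx.
have PE : (P^t* *m P) ord0 ord0 = y^* * y.
  rewrite !mxE big_split_ord/= big_ord1 [X in _ + X]big1 ?addr0.
    by rewrite !mxE lshift0.
  move=> i _; rewrite !mxE.
  by have /matrixP/(_ i 0) := q0; rewrite !mxE lshift0 => ->; rewrite mulr0.
have XE : (X *m X^t*) ord0 ord0 = x * x^* * (1 + ((g *m M) *m (g *m M)^t*) 0 0).
  rewrite !mxE big_split_ord/= big_ord1 mulrDr mulr1; congr (_ + _).
    by rewrite !mxE lshift0.
  rewrite mulr_sumr; apply: eq_bigr => i _.
  have /matrixP/(_ 0 i) := bE; rewrite !mxE lshift0 => ->.
  by rewrite rmorphM; ring.
rewrite PE XE.
have -> : x * x^* * (1 + ((g *m M) *m (g *m M)^t*) 0 0) * (y^* * y) =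
   (x * y) * (x * y)^* * (1 + ((g *m M) *m (g *m M)^t*) 0 0) by rewrite rmorphM/=; ring.
rewrite xy1 rmorph1 !mul1r; congr (1 + _).
rewrite trmx_mul map_mxM -!mulmxA mulmxA mulmxA -[g *m M *m _]mulmxA.
rewrite mxE [RHS]exchange_big; apply: eq_bigr => l _.
by rewrite [X in X * _]mxE mulr_suml; apply: eq_bigr => k _; rewrite !mxE.
Qed.

Lemma resolvent_block n z (A : 'M[C]_(1 + n)) : upper_mx A -> (forall i, A i i != z) ->
  let d := (z - A ord0 ord0)^-1 in let M := invmx (z%:M - drsubmx A) in
  invmx (z%:M - A) = block_mx d%:M (d *: (ursubmx A *m M)) 0 M.
Proof.
move=> uA Az d M.
have u1 : z%:M - A \in unitmx by exact: resolvent_unitmx.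
have u2 : z%:M - drsubmx A \in unitmx.
  apply: resolvent_unitmx => [|i]; first exact: upper_drsubmx.
  by rewrite !mxE.
have d0 : z - A ord0 ord0 != 0 by rewrite subr_eq0 eq_sym.
set B := block_mx _ _ _ _.
suff AB : (z%:M - A) *m B = 1%:M by rewrite -[B]mul1mx -(mulVmx u1) -mulmxA AB mulmx1.
have zE : z%:M = block_mx z%:M 0 0 z%:M :> 'M[C]_(1 + n) by rewrite scalar_mx_block.
rewrite {1}(upper_block uA) zE opp_block_mx add_block_mx /B mulmx_block.
rewrite !(mulmx0, subr0, sub0r, addr0, mul0mx, add0r, oppr0) mulmxV//.
rewrite -raddfB -scalar_mxM/= divff// mul_scalar_mx scalerA divff// scale1r mulNmx subrr.
by rewrite -scalar_mx_block.
Qed.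

End overlap.

(** * The Gaussian array *)

Section gaussian.
Variable R : realType.
Notation C := R[i].
Notation plane := (measurableTypeR R * measurableTypeR R)%type.

Lemma conjcE (w : C) : Num.conj w = w^*%C. Proof. by []. Qed.

Lemma abs2E (w : C) : (abs2 w)%:C%C = w * Num.conj w.
Proof.
case: w => x y; rewrite conjcE /abs2 /= sqr_sqrtr ?addr_ge0 ?sqr_ge0//.
apply/eqP; rewrite eq_complex /=; apply/andP; split; apply/eqP; ring.
Qed.

Lemma abs2_neq0 (w : C) : (abs2 w != 0) = (w != 0).
Proof.
rewrite -(inj_eq (@complexI R)) abs2E mulf_eq0 conjc_eq0 orbb.
by [].
Qed.

Variable v : R.
Hypothesis v_gt0 : 0 < v.
Let s := Num.sqrt (v / 2).

Let sE : s ^+ 2 = v / 2.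
Proof. by rewrite sqr_sqrtr// divr_ge0// ltW. Qed.

Let s_neq0 : s != 0.
Proof. by rewrite gt_eqF// sqrtr_gt0 divr_gt0. Qed.

Let vV_gt0 : 0 < v^-1. Proof. by rewrite invr_gt0. Qed.

Let pdfE x : normal_pdf 0 s x = normal_peak s * gauss v^-1 x.
Proof.
rewrite normal_pdfE//; congr (_ * _).
by rewrite /normal_fun /gauss subr0 sE; congr expR; field; rewrite gt_eqF.
Qed.

Let mom k := normal_peak s * moment v^-1 k.

Let has_integral_normal k : has_integral (normal_prob 0 s) (fun x => x ^+ k) (mom k).
Proof.
apply: (@has_integral_density _ _ _ _ (@lebesgue_measure R) (normal_pdf 0 s)).
- by move=> x; exact: normal_pdf_ge0.
- exact: measurable_normal_pdf.
- by [].
- exact: measurable_funX.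
have := has_integralZ (normal_peak s) (has_integral_moment vV_gt0 k).
by congr has_integral; apply/funext => x; rewrite pdfE; ring.
Qed.

Let mom0 : mom 0 = 1.
Proof.
have /(has_integral_unique (has_integral_normal 0)) -> // : 
  has_integral (normal_prob 0 s) (fun x => x ^+ 0) 1.
split; first exact: finite_measure_integrable_cst.
under eq_integral do rewrite expr0.
by rewrite integral_cst// mul1e; exact: probability_setT.
Qed.

Let mom1 : mom 1 = 0.
Proof.
have := momentS vV_gt0 0; rewrite mul0r => /eqP.
by rewrite mulf_eq0 mulf_eq0 pnatr_eq0/= (gt_eqF vV_gt0)/= /mom => /eqP ->; rewrite mulr0.
Qed.

Let mom2 : mom 2 = v / 2.
Proof.
have e : 2 * v^-1 * moment v^-1 2 = moment v^-1 0 by rewrite momentS// mul1r.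
transitivity (v / 2 * mom 0); last by rewrite mom0 mulr1.
by rewrite /mom -e; field; rewrite gt_eqF.
Qed.

Let gaussian_monomial k l :
  has_cintegral (gaussian_C v) (fun p : plane => p.1%:C%C ^+ k * p.2%:C%C ^+ l)
    (mom k * mom l)%:C%C.
Proof.
have := has_cintegral_real (has_integral_prod (has_integral_normal k) (has_integral_normal l)).
by congr has_cintegral; apply/funext => p; rewrite !rmorphM !rmorphXn.
Qed.

Let gval (b1 b2 : bool) : C :=
  if b1 && b2 then v%:C%C else (~~ b1 && ~~ b2)%:R.

Let gaussian_moment (b1 b2 : bool) :
  has_cintegral (gaussian_C v)
    (fun p : plane => toC p ^+ b1 * (Num.conj (toC p)) ^+ b2) (gval b1 b2).
Proof.
have ii : 'i%C * 'i%C = -1 :> C by rewrite -expr2 sqr_i.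
have m10 := gaussian_monomial 1 0; have m01 := has_cintegralZ 'i%C (gaussian_monomial 0 1).
have h2 : (v / 2)%:C%C + (v / 2)%:C%C = v%:C%C by rewrite -rmorphD -splitr.
rewrite /gval; case: b1; case: b2 => /=.
- have := has_cintegralD (gaussian_monomial 2 0) (gaussian_monomial 0 2).
  rewrite mom0 mom2 mul1r mulr1 h2; congr has_cintegral; apply/funext => p.
  by rewrite conjcE conj_toCE toCE; ring: ii.
- have := has_cintegralD m10 m01.
  rewrite mom1 mul0r mulr0 mulr0 addr0; congr has_cintegral; apply/funext => p.
  by rewrite toCE; ring.
- have := has_cintegralD m10 (has_cintegralZ (-1) m01).
  rewrite mom1 mul0r !mulr0 addr0; congr has_cintegral; apply/funext => p.
  by rewrite conjcE conj_toCE; ring.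
- have := gaussian_monomial 0 0.
  by rewrite mom0 mulr1; congr has_cintegral; apply/funext => p; rewrite !expr0.
Qed.

Lemma gaussian_C_mass : has_cintegral (gaussian_C v) (fun=> 1 : C) 1.
Proof.
have := gaussian_moment false false; congr has_cintegral; apply/funext => p.
by rewrite !expr0 mulr1.
Qed.

Variable m : nat.

Let prod_pick (k : 'I_m) (f : 'I_m -> C) : \prod_i f i ^+ (i == k) = f k.
Proof.
rewrite (bigD1 k)//= eqxx expr1 big1 ?mulr1// => i /negbTE ->.
by rewrite expr0.
Qed.

Lemma row_moment1 (k : 'I_m) :
  has_cintegral (power_measure (gaussian_C v) m) (fun r => toC (tnth r k)) 0.
Proof.
have := has_cintegral_power (fun i : 'I_m => gaussian_moment (i == k) false).
congr has_cintegral.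
  apply/funext => r; rewrite -[RHS](prod_pick k (fun i => toC (tnth r i))).
  by apply: eq_bigr => i _; rewrite expr0 mulr1.
by rewrite (bigD1 k)//= /gval eqxx mul0r.
Qed.

Lemma row_conj_moment1 (k : 'I_m) :
  has_cintegral (power_measure (gaussian_C v) m) (fun r => Num.conj (toC (tnth r k))) 0.
Proof. by have := has_cintegral_conj (row_moment1 k); rewrite conjc0. Qed.

(** The second moments of a row: for [k = l] the variance of an entry, and for
    [k <> l] a product of two vanishing means. *)
Lemma row_covariance (k l : 'I_m) :
  has_cintegral (power_measure (gaussian_C v) m)
    (fun r => toC (tnth r k) * Num.conj (toC (tnth r l))) ((k == l)%:R * v%:C%C).
Proof.
have := has_cintegral_power (fun i : 'I_m => gaussian_moment (i == k) (i == l)).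
congr has_cintegral.
  apply/funext => r; rewrite big_split/= prod_pick; congr (_ * _).
  exact: (prod_pick l (fun i => Num.conj (toC (tnth r i)))).
rewrite (bigD1 k)//= /gval eqxx/=; case: eqVneq => [<-|_]; last by rewrite mul0r mul0r.
rewrite mul1r big1 ?mulr1// => i /negbTE ->.
by [].
Qed.

End gaussian.

Section gram.
Variables (R : realType) (v : R) (m : nat) (z : R[i]).
Hypothesis v_gt0 : 0 < v.
Notation C := R[i].
Notation plane := (measurableTypeR R * measurableTypeR R)%type.
Notation row_law := (power_measure (gaussian_C v) m).
Local Open Scope sesquilinear_scope.

(** The rows of [g] keep their length [m] while the matrix shrinks in the
    induction; [e] tells which entries of a row the matrix reads. *)
Definition tri_mx p (lam : 'I_p -> C) (e : 'I_p -> 'I_m)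
    (g : p.-tuple (m.-tuple plane)) : 'M[C]_p :=
  \matrix_(i, j) if (i < j)%N then toC (tnth (tnth g i) (e j))
                 else if i == j then lam i else 0.

Lemma tri_mx_upper p lam e g : upper_mx (@tri_mx p lam e g).
Proof.
move=> i j ji; rewrite mxE ltnNge (ltnW ji)/=.
by case: eqVneq ji => // ->; rewrite ltnn.
Qed.

Lemma tri_mx_diag p lam e g i : @tri_mx p lam e g i i = lam i.
Proof. by rewrite mxE ltnn eqxx. Qed.

Lemma tri_mx_ursub p (lam : 'I_p.+1 -> C) e g (k : 'I_p) :
  ursubmx (tri_mx lam e g : 'M[C]_(1 + p)) 0 k =
  toC (tnth (thead g) (e (lift ord0 k))).
Proof.
rewrite !mxE lshift0 rshift1 /= ; congr (toC (tnth _ _)).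
Qed.

Lemma tri_mx_drsub p (lam : 'I_p.+1 -> C) e g :
  drsubmx (tri_mx lam e g : 'M[C]_(1 + p)) =
  tri_mx (fun k : 'I_p => lam (lift ord0 k)) (fun k : 'I_p => e (lift ord0 k))
    [tuple of behead g].
Proof.
apply/matrixP => i j; rewrite !mxE !rshift1 /= /bump /= !add1n ltnS.
rewrite (inj_eq (@lift_inj _ _)).
by rewrite tnth_behead -lift0 inord_val.
Qed.

Definition resolvent_gram p (lam : 'I_p -> C) e g : 'M[C]_p :=
  invmx (z%:M - tri_mx lam e g) *m (invmx (z%:M - tri_mx lam e g))^t*.

(** Multiply out [resolvent_block] with its adjoint. *)
Lemma resolvent_gram_block p (lam : 'I_p.+1 -> C) e (g : p.+1.-tuple (m.-tuple plane)) :
  (forall i, lam i != z) ->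
  let d := (z - lam ord0)^-1 in
  let S := resolvent_gram (fun k : 'I_p => lam (lift ord0 k))
    (fun k : 'I_p => e (lift ord0 k)) [tuple of behead g] in
  let u (k : 'I_p) := toC (tnth (thead g) (e (lift ord0 k))) in
  [/\ resolvent_gram lam e g ord0 ord0 =
        d * Num.conj d * (1 + \sum_k \sum_l u k * S k l * Num.conj (u l) ),
      forall l : 'I_p, resolvent_gram lam e g ord0 (lift ord0 l) =
        d * \sum_k u k * S k l,
      forall k : 'I_p, resolvent_gram lam e g (lift ord0 k) ord0 =
        Num.conj d * \sum_l S k l * Num.conj (u l) &
      forall k l : 'I_p, resolvent_gram lam e g (lift ord0 k) (lift ord0 l) = S k l].
Proof.
move=> lz d S u.
pose A : 'M[C]_(1 + p) := tri_mx lam e g.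
pose M := invmx (z%:M - drsubmx A).
have SE : S = M *m M^t*.
  by rewrite /S /resolvent_gram /M /A tri_mx_drsub.
have uE : ursubmx A = \row_k u k by apply/rowP => k; rewrite tri_mx_ursub mxE.
have GE : resolvent_gram lam e g = block_mx d%:M (d *: (ursubmx A *m M)) 0 M *m
   (block_mx d%:M (d *: (ursubmx A *m M)) 0 M)^t*.
  rewrite /resolvent_gram -[tri_mx lam e g]/A resolvent_block.
  - by rewrite tri_mx_diag.
  - exact: tri_mx_upper.
  - by move=> i; rewrite tri_mx_diag.
move: GE; rewrite tr_block_mx map_block_mx mulmx_block.
rewrite !raddf0 ?map_mx0 ?trmx0 !(mulmx0, mul0mx, addr0, add0r) => GE.
move: GE.
have trE : (d *: (ursubmx A *m M))^t* = Num.conj d *: (M^t* *m (ursubmx A)^t*).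
  by rewrite linearZ/= map_mxZ trmx_mul map_mxM.
rewrite trE -!scalemxAl -!scalemxAr !mulmxA -[_ *m M *m M^t*]mulmxA -SE => GE.
have l0 : ord0 = lshift p (ord0 : 'I_1) by rewrite lshift0.
split.
- rewrite GE l0 (@block_mxEul _ 1 p 1 p).
  rewrite scalerA -mulmxA uE !mxE big_ord1 !mxE eqxx !mulr1n.
  rewrite [RHS]mulrDr mulr1; congr (_ + _ * _).
  apply: eq_bigr => k _; rewrite !mxE mulr_sumr; apply: eq_bigr => l _.
  by rewrite !mxE mulrA.
- move=> l; rewrite GE -rshift1 l0 (@block_mxEur _ 1 p 1 p).
  rewrite uE !mxE; congr (_ * _); apply: eq_bigr => k _; rewrite !mxE//.
- move=> k; rewrite GE -rshift1 l0 (@block_mxEdl _ 1 p 1 p).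
  rewrite uE !mxE; congr (_ * _); apply: eq_bigr => l _; rewrite !mxE//.
- by move=> k l; rewrite GE -!rshift1 (@block_mxEdr _ 1 p 1 p).
Qed.

Lemma row_law_mass : has_cintegral row_law (fun=> 1 : C) 1.
Proof. exact/has_cintegral_power1/gaussian_C_mass. Qed.

(** The first row is independent of [S], and its entries are uncorrelated, so
    only the diagonal of the expectation of [S] contributes. *)
Lemma quadratic_form_expectation p (S : p.-tuple (m.-tuple plane) -> 'M[C]_p)
    (tau : 'I_p -> C) (e : 'I_p -> 'I_m) :
  injective e ->
  (forall k l, has_cintegral (power_measure row_law p) (fun g => S g k l)
     ((k == l)%:R * tau k)) ->
  has_cintegral (power_measure row_law p.+1)
    (fun g => \sum_k \sum_l toC (tnth (thead g) (e k)) * S [tuple of behead g] k l *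
       Num.conj (toC (tnth (thead g) (e l))))
    (v%:C%C * \sum_k tau k).
Proof.
move=> einj SE.
have := has_cintegral_sum (index_enum 'I_p) (P := xpredT) (fun k _ =>
  has_cintegral_sum (index_enum 'I_p) (P := xpredT) (fun l _ =>
    has_cintegral_cons (row_covariance v_gt0 (e k) (e l)) (SE k l))).
apply: has_cintegral_eq => [g|].
  by apply: eq_bigr => k _; apply: eq_bigr => l _ /=; rewrite mulrAC.
rewrite mulr_sumr; apply: eq_bigr => k _.
rewrite (bigD1 k)//= !eqxx !mul1r big1 => [|l lk]; first by rewrite addr0.
by rewrite (inj_eq einj) eq_sym (negbTE lk) !mul0r.
Qed.

(** When a row is added on top of the matrix, the Gram entries between the new
    row and the old ones are linear in that row, which is centered and independent of
    the rest, so they average to zero, while the new diagonal entry averages to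
    [|z - lam ord0|^-2 * (1 + v * \sum_k tau k)]. Hence [1 + v * \sum_k tau k] is
    multiplied by [1 + v / |z - lam ord0|^2]. *)
Lemma resolvent_gram_expectation p (lam : 'I_p -> C) (e : 'I_p -> 'I_m) :
  (forall i, lam i != z) -> injective e ->
  exists2 tau : 'I_p -> C,
    forall k l, has_cintegral (power_measure row_law p)
      (fun g => resolvent_gram lam e g k l) ((k == l)%:R * tau k) &
    1 + v%:C%C * \sum_k tau k = \prod_k (1 + (v / abs2 (z - lam k))%:C%C).
Proof.
elim: p lam e => [|p IH] lam e lz einj.
  by exists (fun=> 0) => [[]|]//; rewrite !big_ord0 mulr0 addr0.
have [//||tau gramE tauE] := IH (fun k => lam (lift ord0 k)) (fun k => e (lift ord0 k)).
  by move=> i j /einj /lift_inj.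
pose d := (z - lam ord0)^-1.
pose c0 : C := d * Num.conj d * (1 + v%:C%C * \sum_k tau k).
exists (fun k => if unlift ord0 k is Some j then tau j else c0); last first.
  rewrite big_ord_recl unlift_none big_ord_recl -tauE.
  under eq_bigr do rewrite liftK.
  rewrite /c0; set s := \sum_k _.
  have -> : (v / abs2 (z - lam ord0))%:C%C = v%:C%C * (d * Num.conj d).
    by rewrite rmorphM fmorphV /= abs2E invfM /d; congr (_ * (_ * _)); rewrite -fmorphV.
  by ring.
pose S (g : p.-tuple (m.-tuple plane)) :=
  resolvent_gram (fun k : 'I_p => lam (lift ord0 k))
    (fun k : 'I_p => e (lift ord0 k)) g.
have block g := resolvent_gram_block e g lz.
have einj' : injective (fun k : 'I_p => e (lift ord0 k)).
  by move=> i j /einj /lift_inj.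
move=> k l; case: (unliftP ord0 k) => [k'|] ->; case: (unliftP ord0 l) => [l'|] ->.
- rewrite (inj_eq (@lift_inj _ _)).
  have := has_cintegral_cons row_law_mass (gramE k' l').
  apply: has_cintegral_eq => [g|]; last by rewrite mul1r.
  by have [_ _ _ ->] := block g; rewrite mul1r.
- have := has_cintegralZ (Num.conj d) (has_cintegral_sum (index_enum 'I_p) (P := xpredT)
    (fun l' _ => has_cintegral_cons (row_conj_moment1 v_gt0 (e (lift ord0 l'))) (gramE k' l'))).
  apply: has_cintegral_eq => [g|].
    have [_ _ -> _] := block g; congr (_ * _); apply: eq_bigr => l' _; exact: mulrC.
  by rewrite big1 ?mulr0 ?mul0r// => l' _; rewrite mul0r.
- have := has_cintegralZ d (has_cintegral_sum (index_enum 'I_p) (P := xpredT)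
    (fun k' _ => has_cintegral_cons (row_moment1 v_gt0 (e (lift ord0 k'))) (gramE k' l'))).
  apply: has_cintegral_eq => [g|].
    by have [_ -> _ _] := block g.
  by rewrite big1 ?mulr0 ?mul0r// => k' _; rewrite mul0r.
have := has_cintegralZ (d * Num.conj d) (has_cintegralD
  (has_cintegral_power1 p.+1 row_law_mass) (quadratic_form_expectation einj' gramE)).
apply: has_cintegral_eq => [g|]; last by rewrite eqxx mul1r.
by have [-> _ _ _] := block g.
Qed.

End gram.

(** * The conditional expectation given the spectrum *)

Section given_spectrum.
Variables (R : realType) (z : R[i]) (n : nat).
Notation C := R[i].
Notation plane := (measurableTypeR R * measurableTypeR R)%type.
Local Open Scope sesquilinear_scope.

(** Distinct diagonal entries make a triangular matrix diagonalizable, with the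
    eigenvalues in the order of the diagonal. *)
Lemma is_overlap_mx_exists p (A : 'M[C]_p) : upper_mx A ->
  injective (fun i => A i i) -> exists O, is_overlap_mx A (\row_i A i i) O.
Proof.
move=> uA Ai; have [V Vu VA] := upper_diagonalize uA Ai.
exists (\matrix_(i, j) (((V^t*)^t* *m V^t*) i j * ((invmx V)^t* *m invmx V) j i)).
exists (invmx V); exists (V^t* ); split => //.
- apply: (can_inj (mulKmx Vu)).
  by rewrite !mulmxA VA mulmxV// mul1mx -mulmxA mulmxV// mulmx1.
- by rewrite trmxCK.
- by rewrite trmxCK mulmxV.
Qed.

Variable lam : n.-tuple plane.

Let spec (i : 'I_n.+1) := spectrum z lam 0 i.

Lemma spectrum0 : spectrum z lam 0 ord0 = z.
Proof. by rewrite mxE (tnth_nth 0). Qed.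

Lemma spectrumS (k : 'I_n) : spectrum z lam 0 (lift ord0 k) = toC (tnth lam k).
Proof.
rewrite mxE (tnth_nth 0) lift0 /= (nth_map (tnth lam k)) ?size_tuple//.
by rewrite -tnth_nth.
Qed.

Hypothesis spec_inj : injective (fun i => spectrum z lam 0 i).

Let e0 (k : 'I_n) : 'I_n.+1 := lift ord0 k.
Let tail_spec (k : 'I_n) := toC (tnth lam k).

Lemma schur_mxE g : schur_mx z lam g = tri_mx spec id g.
Proof. by []. Qed.

Lemma overlap_mxE g : overlap_mx (schur_mx z lam g) (spectrum z lam) ord0 ord0 =
  1 + \sum_k \sum_l toC (tnth (thead g) (e0 k)) *
      resolvent_gram z tail_spec e0 [tuple of behead g] k l *
      Num.conj (toC (tnth (thead g) (e0 l))).
Proof.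
pose A : 'M[C]_(1 + n) := tri_mx spec id g.
have uA : upper_mx A by exact: tri_mx_upper.
have Ad i : A i i = spec i by exact: tri_mx_diag.
have Ai : injective (fun i => A i i) by move=> i j; rewrite !Ad => /spec_inj.
have sE : spectrum z lam = \row_i A i i by apply/rowP => i; rewrite [RHS]mxE Ad.
have ex := is_overlap_mx_exists uA Ai.
rewrite schur_mxE -/A sE.
have [P [L [AP LA LP OE]]] : is_overlap_mx A (\row_i A i i) (overlap_mx A (\row_i A i i)).
  by rewrite /overlap_mx; exact: xgetPex ex.
rewrite OE mxE.
have := upper_overlap uA Ai AP LA LP; rewrite trmxCK => ->.
have dE : drsubmx A = tri_mx tail_spec e0 [tuple of behead g].
  rewrite /A tri_mx_drsub; congr tri_mx.
  by apply/funext => k; rewrite /spec spectrumS.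
rewrite Ad /spec spectrum0 dE.
congr (1 + _); apply: eq_bigr => k _; apply: eq_bigr => l _.
by rewrite !tri_mx_ursub.
Qed.

Lemma expected_overlap :
  (\int[gaussian_array R n]_g (diag_overlap z lam g)%:E =
   (\prod_(k < n) (1 + n.+1%:R^-1 / abs2 (z - toC (tnth lam k))))%:E)%E.
Proof.
have v_gt0 : 0 < n.+1%:R^-1 :> R by rewrite invr_gt0 ltr0n.
have lz k : tail_spec k != z.
  apply/eqP; rewrite /tail_spec -spectrumS -{2}spectrum0 => /spec_inj /eqP.
  by rewrite eq_sym (negbTE (neq_lift _ _)).
have e0_inj : injective e0 by exact: lift_inj.
have [tau gramE tauE] := resolvent_gram_expectation v_gt0 lz e0_inj.
have := has_cintegralD
  (has_cintegral_power1 n.+1 (row_law_mass n.+1 v_gt0))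
  (quadratic_form_expectation v_gt0 e0_inj gramE).
rewrite tauE => -[[_ +] _].
under [X in X = _ -> _]eq_integral do rewrite -overlap_mxE.
move=> ->; congr (_%:E).
rewrite -[RHS](_ : complex.Re
  (\prod_(k < n) (1 + n.+1%:R^-1 / abs2 (z - toC (tnth lam k))))%:C%C = _)//.
congr complex.Re; rewrite rmorph_prod; apply: eq_bigr => k _.
by rewrite rmorphD rmorph1.
Qed.

End given_spectrum.

(** * The Andreief identity and tridiagonal determinants *)

Section andreief.
Context (R : realType) (d : measure_display) (T : measurableType d).
Variable mu : {sigma_finite_measure set T -> \bar R}.
Notation C := R[i].

(** Expand both determinants over permutations [s] and [t] and integrate factor by
    factor; for each [s] the sum over [t] is the determinant of [M] with its rows
    permuted, and the two signs of [s] cancel. *)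
Lemma andreief n (phi psi : 'I_n -> T -> C) (M : 'M[C]_n) :
  (forall i j, has_cintegral mu (fun x => phi i x * psi j x) (M i j)) ->
  has_cintegral (power_measure mu n)
    (fun t => \det (\matrix_(k, i) phi i (tnth t k)) *
              \det (\matrix_(k, j) psi j (tnth t k)))
    (n`!%:R * \det M).
Proof.
move=> phipsi.
have := has_cintegral_sum (index_enum {perm 'I_n}) (P := xpredT) (fun s _ =>
  has_cintegral_sum (index_enum {perm 'I_n}) (P := xpredT) (fun t _ =>
    has_cintegralZ ((-1) ^+ s * (-1) ^+ t)
      (has_cintegral_power (fun k : 'I_n => phipsi (s k) (t k))))).
apply: has_cintegral_eq => [x|].
  rewrite /determinant big_distrl/=; apply: eq_bigr => s _.
  rewrite big_distrr/=; apply: eq_bigr => t _.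
  rewrite mulrACA -big_split/=; congr (_ * _).
  by apply: eq_bigr => k _; rewrite !mxE.
rewrite (eq_bigr (fun=> \det M)) => [|s _].
  by rewrite sumr_const card_Sn mulr_natl.
have -> : \det M = (-1) ^+ s * \det (row_perm s M).
  by rewrite row_permE det_mulmx det_perm mulrA -expr2 sqrr_sign mul1r.
rewrite /determinant big_distrr/=; apply: eq_bigr => t _.
by rewrite mulrA; congr (_ * _); apply: eq_bigr => k _; rewrite mxE.
Qed.

End andreief.

Section tridiagonal.
Variables (F : fieldType) (alpha beta gamma D : nat -> F).
Hypothesis D0 : D 0 = 1.
Hypothesis D1 : D 1 = alpha 0.
Hypothesis DS : forall k, D k.+2 = alpha k.+1 * D k.+1 - beta k * gamma k * D k.
Hypothesis D_neq0 : forall k, D k != 0.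

Definition tridiagonal n : 'M[F]_n :=
  \matrix_(i, j) ((i == j)%:R * alpha i + (j == i.+1 :> nat)%:R * beta i +
                  (i == j.+1 :> nat)%:R * gamma j).

Let lower n : 'M[F]_n :=
  \matrix_(i, j) ((j == i)%:R * (D i.+1 / D i) + (i == j.+1 :> nat)%:R * gamma j).

Let upper n : 'M[F]_n :=
  \matrix_(i, j) ((i == j)%:R + (j == i.+1 :> nat)%:R * (beta i * D i / D i.+1)).

Lemma sum_delta n (k : 'I_n) (G : 'I_n -> F) :
  \sum_(j < n) (j == k)%:R * G j = G k.
Proof.
rewrite (bigD1 k)//= eqxx mul1r big1 ?addr0// => j /negbTE ->.
by rewrite mul0r.
Qed.

Let lower_upper n : lower n *m upper n = tridiagonal n.
Proof.
apply/matrixP => i j; rewrite !mxE.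
under eq_bigr do rewrite !mxE mulrDl -mulrA.
rewrite big_split/= sum_delta.
have Di := D_neq0 i.
have DSi := D_neq0 i.+1.
case: i Di DSi => -[|i] lti /= Di DSi.
  rewrite big1 => [|k _]; last by rewrite mul0r mul0r.
  rewrite D0 D1 -(inj_eq val_inj)/=.
  rewrite mul0r !addr0 divr1 mulrDr [_%:R * alpha 0]mulrC; congr (_ + _).
  have a0 : alpha 0 != 0 by rewrite -D1.
  by rewrite mulr1; field.
have lti' : (i < n)%N by exact: ltnW.
under eq_bigr => k _.
  rewrite eqSS [(i == k :> nat)]eq_sym -mulrA (_ : (k == i :> nat) = (k == Ordinal lti'))//.
  over.
rewrite sum_delta /= -!(inj_eq val_inj)/=.
have Di' := D_neq0 i.
rewrite eqSS [(i == j :> nat)%N]eq_sym.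
have -> : (j == i :> nat)%:R * gamma j = (j == i :> nat)%:R * gamma i.
  by case: eqVneq => [->|]; rewrite ?mul0r.
have -> : alpha i.+1 = (D i.+2 + beta i * gamma i * D i) / D i.+1.
  by rewrite DS subrK mulfK.
rewrite [(i.+1 == j)%N]eq_sym.
set b1 := (_ == i.+1)%:R; set b2 := (_ == i.+2)%:R; set b3 := (_ == i)%:R.
by field; rewrite Di DSi.
Qed.

(** The hypotheses on [D] are the three-term recurrence of the leading principal
    minors. As they do not vanish, the matrix has an LU factorization whose
    pivots are the quotients [D i.+1 / D i]. *)
Lemma det_tridiagonal n : \det (tridiagonal n) = D n.
Proof.
rewrite -lower_upper det_mulmx.
have -> : \det (upper n) = 1.
  rewrite -det_tr det_trig ?big1// => [i _|].
    by rewrite !mxE eqxx (ltn_eqF (ltnSn i)) mul0r addr0.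
  apply/is_trig_mxP => i j ij; rewrite !mxE -(inj_eq val_inj)/= gtn_eqF//.
  by rewrite ltn_eqF ?mul0r ?addr0// ltnS ltnW.
rewrite mulr1 det_trig => [|].
  elim: n => [|n IH]; first by rewrite big_ord0 D0.
  rewrite big_ord_recr/= !mxE eqxx (ltn_eqF (ltnSn n)) mul0r addr0 mul1r.
  suff -> : \prod_(i < n) lower n.+1 (widen_ord (leqnSn n) i)
                                     (widen_ord (leqnSn n) i) = D n.
    by rewrite mulrC divfK.
  rewrite -IH; apply: eq_bigr => i _.
  by rewrite !mxE !eqxx.
apply/is_trig_mxP => i j ij; rewrite !mxE -(inj_eq val_inj)/= gtn_eqF//.
by rewrite ltn_eqF ?mul0r ?addr0// ltnS ltnW.
Qed.

End tridiagonal.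

(** * Averaging over the spectrum *)

Section recurrences.
Variables (R : realFieldType) (s eps : R).

(** [k`! * eps ^+ k] times the sum of [x ^+ j / j`!] over [j <= k], at [x = s / eps]. *)
Fixpoint trunc_exp (k : nat) : R :=
  if k is j.+1 then s ^+ k + k%:R * eps * trunc_exp j else 1.

(** [k`! * eps ^+ k] times the sum of [(k + 1 - j) * x ^+ j / j`!] over [j <= k], at
    [x = s / eps]. *)
Fixpoint trunc_exp_sum (k : nat) : R :=
  if k is j.+1 then trunc_exp k + k%:R * eps * trunc_exp_sum j else 1.

Lemma trunc_exp_rec k : trunc_exp k.+2 =
  (s + 0 + k.+2%:R * eps) * trunc_exp k.+1 - s * (k.+1%:R * eps) * trunc_exp k.
Proof.
have -> : trunc_exp k.+2 = s ^+ k.+2 + k.+2%:R * eps * trunc_exp k.+1 by [].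
have -> : s ^+ k.+2 = s * (trunc_exp k.+1 - k.+1%:R * eps * trunc_exp k).
  by rewrite /= exprS addrK.
by ring.
Qed.

(** This identity turns the first-order recurrence of [trunc_exp_sum], in which
    [trunc_exp] is a source term, into a three-term recurrence. *)
Lemma trunc_exp_sumE k : eps * trunc_exp_sum k =
  s ^+ k.+1 + (k.+1%:R * eps - s) * trunc_exp k.
Proof.
elim: k => [|k IH]; first by rewrite /= expr1; ring.
have -> : trunc_exp_sum k.+1 = trunc_exp k.+1 + k.+1%:R * eps * trunc_exp_sum k by [].
rewrite mulrDr mulrCA IH.
have -> : trunc_exp k.+1 = s ^+ k.+1 + k.+1%:R * eps * trunc_exp k by [].
by rewrite [s ^+ k.+2]exprS; ring.
Qed.

Lemma trunc_exp_sum_rec k : trunc_exp_sum k.+2 =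
  (s + eps + k.+2%:R * eps) * trunc_exp_sum k.+1 - s * (k.+1%:R * eps) * trunc_exp_sum k.
Proof.
have -> : trunc_exp_sum k.+2 = trunc_exp k.+2 + k.+2%:R * eps * trunc_exp_sum k.+1 by [].
have e := trunc_exp_sumE k.+1.
have -> : trunc_exp k.+2 = s * trunc_exp k.+1 + eps * trunc_exp_sum k.+1.
  have -> : trunc_exp k.+2 = s ^+ k.+2 + k.+2%:R * eps * trunc_exp k.+1 by [].
  by rewrite e; ring.
have -> : trunc_exp k.+1 = trunc_exp_sum k.+1 - k.+1%:R * eps * trunc_exp_sum k.
  by rewrite [trunc_exp_sum k.+1]/= addrK.
by ring.
Qed.

Hypotheses (s_gt0 : 0 < s) (eps_ge0 : 0 <= eps).

Lemma trunc_exp_gt0 k : 0 < trunc_exp k.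
Proof.
elim: k => [|k IH] /=; first exact: ltr01.
by rewrite ltr_pwDl ?exprn_gt0// !mulr_ge0// ?ler0n// ltW.
Qed.

Lemma trunc_exp_sum_gt0 k : 0 < trunc_exp_sum k.
Proof.
elim: k => [|k IH]; first exact: ltr01.
have -> : trunc_exp_sum k.+1 = trunc_exp k.+1 + k.+1%:R * eps * trunc_exp_sum k by [].
by rewrite ltr_pwDl ?trunc_exp_gt0// !mulr_ge0// ?ler0n// ltW.
Qed.

End recurrences.

Section weights.
Variables (R : realType) (z : R[i]) (n : nat).
Notation C := R[i].
Notation plane := (measurableTypeR R * measurableTypeR R)%type.
Notation lebC := (@lebesgue_C R).
Let a : R := n.+1%:R.
Let eps : R := n.+1%:R^-1.
Let s : R := abs2 z.
Let a_gt0 : 0 < a. Proof. by rewrite ltr0n. Qed.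

Let t (i : nat) : R := i`!%:R / a ^+ i * moment a 0 ^+ 2.

Let t_gt0 i : 0 < t i.
Proof.
by rewrite mulr_gt0 ?exprn_gt0 ?moment0_gt0// divr_gt0 ?exprn_gt0// ltr0n fact_gt0.
Qed.

Let tS i : t i.+1 = t i * (i.+1%:R * eps).
Proof.
rewrite /t /eps -/a factS natrM [a ^+ i.+1]exprS; field.
by rewrite expf_neq0 gt_eqF.
Qed.

(** The matrix of moments of [|z - w|^2 + c], with row [i] divided by the squared
    norm of [w^i]. *)
Definition shifted_jacobi (c : R) :=
  tridiagonal (fun k => (s + c + k.+1%:R * eps)%:C%C)
    (fun k => - Num.conj z * (k.+1%:R * eps)%:C%C) (fun=> - z) n.

(** Expand [|z - w|^2 = |z|^2 - z * conj w - conj z * w + |w|^2]: each of the four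
    terms shifts the exponents by at most one. *)
Lemma shifted_moment (c : R) (i j : 'I_n) :
  has_cintegral lebC (fun p => (abs2 (z - toC p) + c)%:C%C * cgauss a p * toC p ^+ i *
      (toC p)^*%C ^+ j)
    ((t i)%:C%C * shifted_jacobi c i j).
Proof.
have m i' j' := has_cintegral_cmoment a_gt0 i' j'.
have := has_cintegralD (has_cintegralD (has_cintegralZ (s + c)%:C%C (m i j))
  (has_cintegralZ (- z) (m i j.+1)))
  (has_cintegralD (has_cintegralZ (- Num.conj z) (m i.+1 j)) (m i.+1 j.+1)).
apply: has_cintegral_eq => [p|].
  set w := toC p; rewrite !rmorphD /= /s !abs2E rmorphB /= !conjcE.
  by rewrite [w ^+ _.+1]exprS [w^*%C ^+ _.+1]exprS; ring.
rewrite /cmoment -!/(t _) tS eqSS /shifted_jacobi mxE -(inj_eq val_inj)/=.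
rewrite [(j == i.+1 :> nat)%N]eq_sym !rmorphD !rmorphM /=.
set b1 := (_ == j)%:R; set b2 := (_ == j.+1)%:R; set b3 := (_ == _)%:R.
by ring.
Qed.

Lemma det_scaled_jacobi (c : R) :
  \det (\matrix_(i < n, j < n) ((t i)%:C%C * shifted_jacobi c i j)) =
  (\prod_(i < n) t i)%:C%C * \det (shifted_jacobi c).
Proof.
rewrite [in RHS]rmorph_prod; set r := \row_(i < n) (t i)%:C%C.
have -> : \matrix_(i < n, j < n) ((t i)%:C%C * shifted_jacobi c i j) =
    diag_mx r *m shifted_jacobi c.
  by apply/matrixP => i j; rewrite mul_diag_mx !mxE.
by rewrite det_mulmx det_diag; congr (_ * _); apply: eq_bigr => i _; rewrite mxE.
Qed.

Let s_ge0 : 0 <= s. Proof. exact: sqr_ge0. Qed.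

Hypothesis z_neq0 : z != 0.

Let s_gt0 : 0 < s. Proof. by rewrite lt_def s_ge0 abs2_neq0 z_neq0. Qed.
Let eps_ge0 : 0 <= eps. Proof. by rewrite invr_ge0 ler0n. Qed.

Let conjz k : - Num.conj z * (k.+1%:R * eps)%:C%C * - z = (s * (k.+1%:R * eps))%:C%C.
Proof. by rewrite [RHS]rmorphM/= /s abs2E; ring. Qed.

Lemma det_jacobi0 : \det (shifted_jacobi 0) = (trunc_exp s eps n)%:C%C.
Proof.
apply: (@det_tridiagonal _ _ _ _ (fun k => (trunc_exp s eps k)%:C%C)) => [|| k|k].
- by rewrite rmorph1.
- by rewrite /=; congr (_%:C)%C; ring.
- by rewrite conjz -!rmorphM -rmorphB trunc_exp_rec.
- by rewrite fmorph_eq0 gt_eqF// trunc_exp_gt0.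
Qed.

Lemma det_jacobi_eps : \det (shifted_jacobi eps) = (trunc_exp_sum s eps n)%:C%C.
Proof.
apply: (@det_tridiagonal _ _ _ _ (fun k => (trunc_exp_sum s eps k)%:C%C)) => [|| k|k].
- by rewrite rmorph1.
- by rewrite /=; congr (_%:C)%C; ring.
- by rewrite conjz -!rmorphM -rmorphB trunc_exp_sum_rec.
- by rewrite fmorph_eq0 gt_eqF// trunc_exp_sum_gt0.
Qed.

Lemma abs2M (x y : C) : abs2 (x * y) = abs2 x * abs2 y.
Proof. by rewrite /abs2 normcM exprMn. Qed.

Lemma abs2N (x : C) : abs2 (- x) = abs2 x.
Proof. by rewrite /abs2 normcN. Qed.

(** The product of the [abs2] is the Vandermonde determinant times its conjugate,
    and [h] and the Gaussian factors go into the rows of the first of them. *)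
Lemma weighted_vandermonde (h : plane -> C) (c : R) :
  (forall i j : 'I_n, has_cintegral lebC
     (fun p => h p * cgauss a p * toC p ^+ i * (toC p)^*%C ^+ j)
     ((t i)%:C%C * shifted_jacobi c i j)) ->
  has_cintegral (power_measure lebC n)
    (fun lam => (\prod_(k < n) h (tnth lam k)) *
      ((\prod_(i < n) \prod_(j < n | (i < j)%N)
          abs2 (toC (tnth lam i) - toC (tnth lam j))) *
       expR (- (n.+1%:R * \sum_(k < n) abs2 (toC (tnth lam k)))))%:C%C)
    (n`!%:R * ((\prod_(i < n) t i)%:C%C * \det (shifted_jacobi c))).
Proof.
move=> hM.
have := andreief (M := \matrix_(i, j) ((t i)%:C%C * shifted_jacobi c i j))
  (phi := fun i p => h p * cgauss a p * toC p ^+ i) (psi := fun j p => (toC p)^*%C ^+ j)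
  (mu := lebC).
move=> H.
have {}H := H (fun i j => has_cintegral_eq (fun=> erefl) (esym (mxE _ _ _ _)) (hM i j)).
apply: has_cintegral_eq H => [lam|]; last by rewrite det_scaled_jacobi.
pose V := Vandermonde n (\row_k toC (tnth lam k)).
have -> : \matrix_(k, i) (h (tnth lam k) * cgauss a (tnth lam k) *
                          toC (tnth lam k) ^+ i) =
   diag_mx (\row_k (h (tnth lam k) * cgauss a (tnth lam k))) *m V^T :> 'M[C]_n.
  by apply/matrixP => i j; rewrite mul_diag_mx !mxE.
have -> : \matrix_(k, j) (toC (tnth lam k))^*%C ^+ j = map_mx Num.conj V^T :> 'M[C]_n.
  by apply/matrixP => i j; rewrite !mxE rmorphXn.
rewrite det_mulmx det_map_mx det_tr det_diag.
under eq_bigr do rewrite mxE.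
rewrite big_split/= -mulrA -mulrA; congr (_ * _).
rewrite mulrC rmorphM; congr (_ * _); last first.
  rewrite mulr_sumr -sumrN expR_sum rmorph_prod.
  by apply: eq_bigr => k _.
rewrite -abs2E det_Vandermonde; congr (_%:C)%C.
have abs2_prod (I : finType) (P : pred I) (F : I -> C) :
    abs2 (\prod_(i | P i) F i) = \prod_(i | P i) abs2 (F i).
  apply: (big_morph _ abs2M).
  by rewrite /abs2 normc1 expr1n.
rewrite abs2_prod; apply: eq_bigr => i _; rewrite abs2_prod; apply: eq_bigr => j _.
by rewrite !mxE -abs2N opprB.
Qed.

Definition weight_scale : R := n`!%:R * \prod_(i < n) t i.

Lemma weight_scale_gt0 : 0 < weight_scale.
Proof. by rewrite mulr_gt0 ?ltr0n ?fact_gt0// prodr_gt0. Qed.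

Lemma has_integral_cond_weight :
  has_integral (power_measure lebC n) (fun lam => cond_weight z lam)
    (weight_scale * trunc_exp s eps n).
Proof.
have [i j|H _] := weighted_vandermonde (h := fun p => (abs2 (z - toC p))%:C%C) (c := 0).
  by have := shifted_moment 0 i j; apply: has_cintegral_eq => // p; rewrite addr0.
rewrite det_jacobi0 -rmorphM -[n`!%:R](rmorph_nat (real_complex R)) -rmorphM mulrA in H.
move: H; congr has_integral; apply/funext => lam.
by rewrite -rmorph_prod -rmorphM /= /cond_weight mulrA.
Qed.

Lemma lebesgue_C_singleton : has_integral lebC (\1_[set (complex.Re z, complex.Im z)]) 0.
Proof.
have -> : [set (complex.Re z, complex.Im z)] =
    [set complex.Re z] `*` [set complex.Im z] :> set plane.
  by apply/seteqP; split => [[x y] []|[x y] [/= -> ->]].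
have mA : measurable ([set complex.Re z] `*` [set complex.Im z] : set plane).
  exact: measurableX.
have A0 : lebC ([set complex.Re z] `*` [set complex.Im z]) = 0%E.
  by rewrite /lebesgue_C product_measure1E//= !lebesgue_measure_set1 mul0e.
split; last by rewrite integral_indic// setIT; exact: A0.
apply/integrableP; split; first exact/measurable_EFinP/measurable_indic.
under eq_integral do rewrite /= ger0_norm//.
rewrite integral_indic// setIT; apply: (@le_lt_trans _ _ 0%E); last exact: ltry.
by rewrite le_eqVlt; apply/orP; left; apply/eqP; exact: A0.
Qed.

(** At an eigenvalue different from [z], the factor [abs2 (z - w)] times
    [1 + eps / abs2 (z - w)] is [abs2 (z - w) + eps]; at [w = z] it is zero instead
    of [eps], because [eps / 0 = 0], but that is a single point of the plane. *)
Lemma has_integral_tilted_weight :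
  has_integral (power_measure lebC n)
    (fun lam => cond_weight z lam *
       \prod_(k < n) (1 + n.+1%:R^-1 / abs2 (z - toC (tnth lam k))))
    (weight_scale * trunc_exp_sum s eps n).
Proof.
pose h p := abs2 (z - toC p) * (1 + eps / abs2 (z - toC p)).
have [i j|H _] := weighted_vandermonde (h := fun p => (h p)%:C%C) (c := eps); last first.
  rewrite det_jacobi_eps -rmorphM in H.
  rewrite -[n`!%:R](rmorph_nat (real_complex R)) -rmorphM mulrA in H.
  move: H; congr has_integral; apply/funext => lam.
  by rewrite -rmorph_prod -rmorphM /= /cond_weight big_split/=; ring.
(* the two weights differ by a multiple of the indicator of the point z *)
pose p0 : plane := (complex.Re z, complex.Im z).
have := has_cintegralD (shifted_moment eps i j)
  (has_cintegralZ (- (eps%:C%C * cgauss a p0 * toC p0 ^+ i * (toC p0)^*%C ^+ j))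
    (has_cintegral_real lebesgue_C_singleton)).
apply: has_cintegral_eq => [p|]; last by rewrite mulr0 addr0.
rewrite indicE; have [->|pp0] := eqVneq p p0.
  have p0z : toC p0 = z by rewrite toCE -complexE.
  have abs20 : abs2 (z - toC p0) = 0 by rewrite p0z subrr /abs2 normc0 expr0n.
  have hp0 : h p0 = 0 by rewrite /h abs20 mul0r.
  rewrite mem_set// mulr1 hp0 abs20 add0r subrr.
  have -> : (0%:C)%C = 0 :> C by [].
  by rewrite !mul0r.
rewrite memNset/=; last by move=> /= e; move: pp0; rewrite e eqxx.
rewrite mulr0 addr0 /h; congr (_%:C%C * _ * _ * _).
rewrite mulrDr mulr1 mulrCA divff ?mulr1// abs2_neq0 subr_eq0.
apply: contra pp0 => /eqP zp; rewrite /p0 zp.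
by case: p {zp}.
Qed.

Lemma cond_partitionE : cond_partition z n = weight_scale * trunc_exp s eps n.
Proof. by rewrite /cond_partition has_integral_cond_weight.2. Qed.

Lemma cond_weight_spectrum_inj (lam : n.-tuple plane) : cond_weight z lam != 0 ->
  injective (fun i => spectrum z lam 0 i).
Proof.
rewrite /cond_weight !mulf_eq0 !negb_or => /andP[/andP[/prodf_neq0 w1 /prodf_neq0 w2] _].
have w1' k : toC (tnth lam k) != z.
  by have := w1 k isT; rewrite abs2_neq0 subr_eq0 eq_sym.
have w2' (k l : 'I_n) : (k < l)%N -> toC (tnth lam k) != toC (tnth lam l).
  by move=> kl; have /prodf_neq0/(_ l kl) := w2 k isT; rewrite abs2_neq0 subr_eq0.
move=> i j; case: (unliftP ord0 i) => [i'|] ->; case: (unliftP ord0 j) => [j'|] ->;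
  rewrite ?spectrumS ?spectrum0 => e //.
- have [ij|ji|/val_inj -> //] := ltngtP i' j'.
    by have := w2' _ _ ij; rewrite e eqxx.
  by have := w2' _ _ ji; rewrite e eqxx.
- by have := w1' i'; rewrite e eqxx.
- by have := w1' j'; rewrite e eqxx.
Qed.

(** Where the density vanishes both integrands are zero; elsewhere the spectrum is
    simple and [expected_overlap] applies. *)
Lemma cond_expect_overlapE :
  cond_expect_overlap z n = (trunc_exp_sum s eps n / trunc_exp s eps n)%:E.
Proof.
have Z0 : weight_scale * trunc_exp s eps n != 0.
  by rewrite gt_eqF// mulr_gt0 ?weight_scale_gt0 ?trunc_exp_gt0.
have [_ wE] := has_integralZ (weight_scale * trunc_exp s eps n)^-1 has_integral_tilted_weight.
have -> : trunc_exp_sum s eps n / trunc_exp s eps n =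
  (weight_scale * trunc_exp s eps n)^-1 * (weight_scale * trunc_exp_sum s eps n).
  by field; move: Z0; rewrite mulf_eq0 negb_or andbC.
rewrite -wE /cond_expect_overlap; apply: eq_integral => lam _.
rewrite /cond_density cond_partitionE.
have [w0|w0] := eqVneq (cond_weight z lam) 0.
  by rewrite w0 !mul0r mulr0 mul0e.
rewrite expected_overlap; last exact: cond_weight_spectrum_inj.
by rewrite -EFinM; congr (_%:E); ring.
Qed.

End weights.

(** * Asymptotics *)

Section asymptotics.
Variables (R : realFieldType) (s eps : R).
Hypotheses (s_gt1 : 1 < s) (eps_ge0 : 0 <= eps).
Notation f := (trunc_exp s eps).
Notation g := (trunc_exp_sum s eps).

Let s_gt0 : 0 < s. Proof. exact: lt_trans s_gt1. Qed.
Let s1_gt0 : 0 < s - 1. Proof. by rewrite subr_gt0. Qed.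

Let defect k := s * f k - (s - k%:R * eps) * g k.
Let kappa := 2 * s / (s - 1) ^+ 2.

Lemma trunc_expS_sum k : f k.+1 = s * f k + eps * g k.
Proof. by rewrite trunc_exp_sumE [f k.+1]/=; ring. Qed.

Let defectS k : defect k.+1 = k.+1%:R * eps * (defect k + 2 * eps * g k).
Proof.
have gS : g k.+1 = f k.+1 + k.+1%:R * eps * g k by [].
by rewrite /defect gS trunc_expS_sum; ring.
Qed.

(** The factor [k.+1%:R * eps] in [defectS] is at most [1], while [trunc_exp] grows by
    a factor [s > 1] at least. The constant [kappa] solves
    [kappa + 2 * s / (s - 1) = s * kappa]. *)
Lemma defect_bounds k : k%:R * eps <= 1 -> 0 <= defect k <= kappa * eps * f k.
Proof.
have f0 j : 0 < f j by exact: trunc_exp_gt0.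
have g0 j : 0 < g j by exact: trunc_exp_sum_gt0.
have kappa_ge0 : 0 <= kappa by rewrite divr_ge0 ?sqr_ge0// mulr_ge0// ltW.
elim: k => [_|k IH ke].
  have -> : defect 0 = 0 by rewrite /defect /=; ring.
  by rewrite lexx; apply: mulr_ge0; [exact: mulr_ge0|exact: ltW].
have ke' : k%:R * eps <= 1 by apply: le_trans ke; rewrite ler_wpM2r// ler_nat.
have ke0 : 0 <= k.+1%:R * eps by rewrite mulr_ge0.
have /andP[d0 dk] := IH ke'.
rewrite defectS; apply/andP; split.
  by rewrite mulr_ge0// addr_ge0// !mulr_ge0// ltW.
have gf : (s - 1) * g k <= s * f k.
  rewrite -subr_ge0; apply: le_trans d0 _; rewrite lerD2l lerN2.
  by rewrite ler_wpM2r ?(ltW (g0 k))// lerD2l lerN2.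
have gf' : g k <= s / (s - 1) * f k.
  by rewrite mulrAC ler_pdivlMr// mulrC.
apply: (@le_trans _ _ (defect k + 2 * eps * g k)).
  by rewrite ler_piMl// addr_ge0// !mulr_ge0// ltW.
apply: (@le_trans _ _ (kappa * eps * f k + 2 * eps * (s / (s - 1) * f k))).
  by apply: lerD => //; rewrite ler_wpM2l// mulr_ge0.
have -> : kappa * eps * f k + 2 * eps * (s / (s - 1) * f k) = kappa * eps * (s * f k).
  by rewrite /kappa; field; rewrite gt_eqF.
apply: ler_wpM2l; first exact: mulr_ge0.
by rewrite trunc_expS_sum lerDl mulr_ge0// ltW.
Qed.

Lemma ratio_error n : n.+1%:R * eps = 1 ->
  `|g n / f n - s / (s - 1)| <= (s / (s - 1) + kappa) / (s - 1) * eps.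
Proof.
move=> ne.
have f0 : 0 < f n by exact: trunc_exp_gt0.
have g0 : 0 < g n by exact: trunc_exp_sum_gt0.
have nE : n%:R * eps = 1 - eps.
  by apply: (addIr eps); rewrite subrK -{2}[eps]mul1r -mulrDl natr1.
have /andP[d0 dk] : 0 <= defect n <= kappa * eps * f n.
  by apply: defect_bounds; rewrite nE gerBl.
have errE : s / (s - 1) - g n / f n = (eps * (g n / f n) + defect n / f n) / (s - 1).
  by rewrite /defect nE; field; rewrite !gt_eqF.
have gf0 : 0 <= g n / f n by rewrite ltW// divr_gt0.
have gf : g n / f n <= s / (s - 1).
  rewrite ler_pdivrMr// mulrAC ler_pdivlMr// mulrC.
  rewrite -subr_ge0; apply: le_trans d0 _; rewrite lerD2l lerN2.
  by rewrite ler_wpM2r ?(ltW g0)// lerD2l lerN2 nE gerBl.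
rewrite distrC errE ger0_norm; last first.
  by apply: divr_ge0 (ltW s1_gt0); apply: addr_ge0;
    [exact: mulr_ge0|exact: divr_ge0 d0 (ltW f0)].
rewrite [leRHS]mulrAC ler_wpM2r ?invr_ge0 ?(ltW s1_gt0)// [leRHS]mulrDl.
by rewrite [eps * _]mulrC lerD ?ler_wpM2r// ler_pdivrMr.
Qed.

End asymptotics.

(* MathComp-Analysis; the matrix size is N = n.+1 *)
Theorem proposition8 (R : realType) (z : R[i]) (hz : 1 < normc z) :
  exists K : R, \forall n \near \oo,
    (`| cond_expect_overlap z n - (normc z ^+ 2 / (normc z ^+ 2 - 1))%:E |
       <= (K / n.+1%:R)%:E)%E.
Proof.
have z_neq0 : z != 0 by apply: contraTneq hz => ->; rewrite normc0 ltr10.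
have s_gt1 : 1 < normc z ^+ 2 by rewrite exprn_egt1.
eexists; apply: nearW => n.
rewrite cond_expect_overlapE// -EFinB lee_fin.
apply: ratio_error => //.
by rewrite mulfV// pnatr_eq0.
Qed.
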